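(* Let $G$ be a Lie group with two-dimensional commutator subalgebra $\mathfrak g'$, $g=\langle\cdot,\cdot\rangle$ a left-invariant Riemannian metric on $G$, $\tilde g$ the natural lifted left-invariant metric on $TG$, and $\widetilde\nabla$ the Levi-Civita connection of $\tilde g$. With $e_1,e_2,\mathcal P,a_1,a_2,b_1,b_2,f_1,f_2$ as in the context, for all $u,v\in\mathcal P$ the following hold. Row $e_1^c$: $\widetilde\nabla_{e_1^c}e_1^c=a_1^c$; $\widetilde\nabla_{e_1^c}e_1^v=\frac12a_1^v$; $\widetilde\nabla_{e_1^c}e_2^c=\frac12(a_2^c+b_1^c)$; $\widetilde\nabla_{e_1^c}e_2^v=\frac12a_2^v$; $\widetilde\nabla_{e_1^c}u^c=-\big(\langle a_1,u\rangle e_1^c+\frac12\langle b_1+a_2,u\rangle e_2^c+\frac12(f_1(u))^c\big)$; $\widetilde\nabla_{e_1^c}u^v=-\frac12\big(\langle a_1,u\rangle e_1^v+\langle a_2,u\rangle e_2^v\big)$. Row $e_1^v$: $\widetilde\nabla_{e_1^v}e_1^c=\frac12a_1^v$; $\widetilde\nabla_{e_1^v}e_1^v=a_1^c$; $\widetilde\nabla_{e_1^v}e_2^c=\frac12b_1^v$; $\widetilde\nabla_{e_1^v}e_2^v=\frac12(a_2^c+b_1^c)$; $\widetilde\nabla_{e_1^v}u^c=-\big(\langle a_1,u\rangle e_1^v+\frac12\langle b_1+a_2,u\rangle e_2^v+\frac12(f_1(u))^v\big)$; $\widetilde\nabla_{e_1^v}u^v=-\frac12\big(\langle a_1,u\rangle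 e_1^c+\langle b_1,u\rangle e_2^c+(f_1(u))^c\big)$. Row $e_2^c$: $\widetilde\nabla_{e_2^c}e_1^c=\frac12(a_2^c+b_1^c)$; $\widetilde\nabla_{e_2^c}e_1^v=\frac12b_1^v$; $\widetilde\nabla_{e_2^c}e_2^c=b_2^c$; $\widetilde\nabla_{e_2^c}e_2^v=\frac12b_2^v$; $\widetilde\nabla_{e_2^c}u^c=-\big(\frac12\langle b_1+a_2,u\rangle e_1^c+\langle b_2,u\rangle e_2^c+\frac12(f_2(u))^c\big)$; $\widetilde\nabla_{e_2^c}u^v=-\frac12\big(\langle b_1,u\rangle e_1^v+\langle b_2,u\rangle e_2^v\big)$. Row $e_2^v$: $\widetilde\nabla_{e_2^v}e_1^c=\frac12a_2^v$; $\widetilde\nabla_{e_2^v}e_1^v=\frac12(a_2^c+b_1^c)$; $\widetilde\nabla_{e_2^v}e_2^c=\frac12b_2^v$; $\widetilde\nabla_{e_2^v}e_2^v=b_2^c$; $\widetilde\nabla_{e_2^v}u^c=-\big(\frac12\langle b_1+a_2,u\rangle e_1^v+\langle b_2,u\rangle e_2^v+\frac12(f_2(u))^v\big)$; $\widetilde\nabla_{e_2^v}u^v=-\frac12\big(\langle a_2,u\rangle e_1^c+\langle b_2,u\rangle e_2^c+(f_2(u))^c\big)$. Row $v^c$: $\widetilde\nabla_{v^c}e_1^c=\frac12\big(\langle a_2-b_1,v\rangle e_2^c-(f_1(v))^c\big)$; $\widetilde\nabla_{v^c}e_1^v=\frac12\big(\langle a_2-b_1,v\rangle e_2^v-(f_1(v))^v\big)$;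 $\widetilde\nabla_{v^c}e_2^c=\frac12\big(\langle b_1-a_2,v\rangle e_1^c-(f_2(v))^c\big)$; $\widetilde\nabla_{v^c}e_2^v=\frac12\big(\langle b_1-a_2,v\rangle e_1^v-(f_2(v))^v\big)$; $\widetilde\nabla_{v^c}u^c=\frac12\big(\langle f_1(v),u\rangle e_1^c+\langle f_2(v),u\rangle e_2^c\big)$; $\widetilde\nabla_{v^c}u^v=\frac12\big(\langle f_1(v),u\rangle e_1^v+\langle f_2(v),u\rangle e_2^v\big)$. Row $v^v$: $\widetilde\nabla_{v^v}e_1^c=\frac12\big(\langle a_1,v\rangle e_1^v+\langle a_2,v\rangle e_2^v\big)$; $\widetilde\nabla_{v^v}e_1^v=-\frac12\big(\langle a_1,v\rangle e_1^c+\langle b_1,v\rangle e_2^c+(f_1(v))^c\big)$; $\widetilde\nabla_{v^v}e_2^c=\frac12\big(\langle b_1,v\rangle e_1^v+\langle b_2,v\rangle e_2^v\big)$; $\widetilde\nabla_{v^v}e_2^v=-\frac12\big(\langle a_2,v\rangle e_1^c+\langle b_2,v\rangle e_2^c+(f_2(v))^c\big)$; $\widetilde\nabla_{v^v}u^c=\frac12\big(\langle f_1(v),u\rangle e_1^v+\langle f_2(v),u\rangle e_2^v\big)$; $\widetilde\nabla_{v^v}u^v=0$.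
   Context: $G$ is a connected $n$-dimensional real Lie group with Lie algebra $\mathfrak g$ (left-invariant vector fields) such that $\mathfrak g'=[\mathfrak g,\mathfrak g]$ has dimension $2$ (equivalently, the commutator subgroup is two-dimensional). $g$ is a left-invariant Riemannian metric on $G$, with induced inner product $\langle\cdot,\cdot\rangle$ on $\mathfrak g$. $\{e_1,e_2\}$ is an orthonormal basis of $\mathfrak g'$ and $\mathcal P$ is the $(n-2)$-dimensional orthogonal complement of $\mathfrak g'$ in $\mathfrak g$. The vectors $a_1,a_2,b_1,b_2\in\mathcal P$ and skew-symmetric linear maps $f_1,f_2:\mathcal P\to\mathcal P$ are uniquely determined by: for all $u,v\in\mathcal P$, $[u,e_1]=\langle a_1,u\rangle e_1+\langle a_2,u\rangle e_2$, $[u,e_2]=\langle b_1,u\rangle e_1+\langle b_2,u\rangle e_2$, $[u,v]=\langle f_1(u),v\rangle e_1+\langle f_2(u),v\rangle e_2$. $TG$ is a Lie group with the tangent map $T\mu$ of the multiplication $\mu$ as product. For a vector field $X$ on $G$, the vertical lift $X^v$ is the infinitesimal generator on $TG$ of the flow $y\mapsto y+tX(x)$, $y\in T_xG$, and the complete lift $X^c$ is the infinitesimal generator of $T\phi_t$, where $\phi_t$ is the (local) flow of $X$. Lifts of left-invariant fields are left-invariant on $TG$, and for a basis $X_1,\dots,X_n$ of $\mathfrak g$ the fields $X_i^c,X_i^v$ form a basis of the Lie algebra of $TG$, with $[X^c,Y^c]=[X,Y]^c$, $[X^c,Y^v]=[X,Y]^v$, $[X^v,Y^v]=0$. The lifted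 left-invariant metric $\tilde g$ on $TG$ is defined by $\tilde g(X^c,Y^c)=\tilde g(X^v,Y^v)=g(X,Y)$, $\tilde g(X^c,Y^v)=0$ for $X,Y\in\mathfrak g$. *)

(* Defs.v *)
From HB Require Import structures.
From mathcomp Require Import all_boot all_order all_algebra.
From mathcomp Require Import all_classical all_reals all_analysis.
Set Implicit Arguments.
Unset Strict Implicit.
Unset Printing Implicit Defensive.
Import Order.TTheory GRing.Theory Num.Theory.
Import numFieldNormedType.Exports.
Local Open Scope classical_set_scope.
Local Open Scope ring_scope.

(* A and f are used with A open and the source finite-dimensional, where
   existence and continuity of all iterated directional derivatives is the
   usual C^oo condition. *)
Fixpoint Ck (R : realType) (E F : normedModType R) (k : nat) (A : set E)
    (f : E -> F) : Prop :=
  match k with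
  | 0 => forall p, A p -> {for p, continuous f}
  | k'.+1 => (forall p, A p -> differentiable f p) /\
             (forall w, Ck k' A (fun p => 'D_w f p))
  end.

Definition smooth (R : realType) (E F : normedModType R) (A : set E)
    (f : E -> F) : Prop := forall k, Ck k A f.

(* Chart i is [coord i], restricted to [dom i]. The type M may be larger than
   the space it carries, which is [carrier]; this is used for the tangent
   bundle. *)
Record atlas (R : realType) (M : Type) (E : normedModType R) := Atlas {
  idx : Type;
  dom : idx -> set M;
  coord : idx -> M -> E }.

(* A vector field is represented by its components in all the charts, and a
   point of the tangent bundle by a base point and the components of a tangent
   vector. These types, and [forms] for (0,2)-tensors, only fix the shape of
   the data; the conditions are [tangent], [vector_field] and [riemannian]. *)
Definition fields (R : realType) (M : Type) (E : normedModType R)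
    (A : atlas M E) : Type := M -> idx A -> E.

Definition bundle (R : realType) (M : Type) (E : normedModType R)
    (A : atlas M E) : Type := (M * (idx A -> E))%type.

Definition forms (R : realType) (M : Type) (E : normedModType R)
    (A : atlas M E) : Type := M -> (idx A -> E) -> (idx A -> E) -> R.

Section Charts.
Context {R : realType} {M : Type} {E : normedModType R} (A : atlas M E).

Definition carrier : set M := \bigcup_i dom (a := A) i.

Definition chart_image (i : idx A) : set E := coord i @` dom i.

(* h \o (coord i)^-1, extended by 0 outside of the image of the chart *)
Definition rep {F : normedModType R} (i : idx A) (h : M -> F) : E -> F :=
  fun p => xget 0 [set h m | m in [set m | dom i m /\ coord i m = p]].

Definition smooth_fun (f : M -> R) : Prop :=
  forall i, smooth (chart_image i) (rep i f).

(* A tangent vector at m is the family of its components in all the charts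
   around m, related by the differentials of the transition maps. Components in
   the other charts are set to 0, so that equality of tangent vectors is
   equality of families. *)
Definition tangent (m : M) : set (idx A -> E) :=
  [set v | (forall i, ~ dom i m -> v i = 0) /\
           (forall i j, dom i m -> dom j m ->
              v j = 'D_(v i) (rep i (coord j)) (coord i m))].

Definition vector_field (X : fields A) : Prop :=
  (forall m, tangent m (X m)) /\
  (forall i, smooth (chart_image i) (rep i (X^~ i))).

(* The value does not depend on the chart i. *)
Definition lie_derivative (X : fields A) (f : M -> R) : M -> R :=
  fun m => xget 0 [set 'D_(X m i) (rep i f) (coord i m)
           | i in [set i | dom i m]].

(* This vanishes in the charts that do not contain m, since X m i = Y m i = 0
   there. *)
Definition bracket (X Y : fields A) : fields A := fun m i =>
  'D_(X m i) (rep i (Y^~ i)) (coord i m)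
  - 'D_(Y m i) (rep i (X^~ i)) (coord i m).

Record riemannian (g : forms A) : Prop := {
  riemannian_linear : forall m a u v w,
    tangent m u -> tangent m v -> tangent m w ->
    g m (a *: u + v) w = a * g m u w + g m v w;
  riemannian_sym : forall m u v,
    tangent m u -> tangent m v -> g m u v = g m v u;
  riemannian_pos : forall m u, tangent m u -> u != 0 -> 0 < g m u u;
  riemannian_smooth : forall X Y, vector_field X -> vector_field Y ->
    smooth_fun (fun m => g m (X m) (Y m)) }.

Record levi_civita (g : forms A)
    (nabla : fields A -> fields A -> fields A) : Prop := {
  connection_field : forall X Y, vector_field X -> vector_field Y ->
    vector_field (nabla X Y);
  connection_linear_l : forall f X X' Y, smooth_fun f ->
    vector_field X -> vector_field X' -> vector_field Y ->
    nabla (fun m => f m *: X m + X' m) Y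
    = (fun m => f m *: nabla X Y m + nabla X' Y m);
  connection_additive_r : forall X Y Y',
    vector_field X -> vector_field Y -> vector_field Y' ->
    nabla X (Y + Y') = nabla X Y + nabla X Y';
  connection_leibniz : forall f X Y, smooth_fun f ->
    vector_field X -> vector_field Y ->
    nabla X (fun m => f m *: Y m)
    = (fun m => lie_derivative X f m *: Y m + f m *: nabla X Y m);
  connection_torsion_free : forall X Y, vector_field X -> vector_field Y ->
    nabla X Y - nabla Y X = bracket X Y;
  connection_metric : forall X Y Z,
    vector_field X -> vector_field Y -> vector_field Z ->
    lie_derivative X (fun m => g m (Y m) (Z m))
    = (fun m => g m (nabla X Y m) (Z m) + g m (Y m) (nabla X Z m)) }.

End Charts.

Section Maps.
Context {R : realType} {M N : Type} {E F : normedModType R}.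

Definition product_atlas (A : atlas M E) (B : atlas N F) :
    atlas (M * N) (E * F)%type :=
  {| idx := (idx A * idx B)%type;
     dom := fun ij => [set x | dom ij.1 x.1 /\ dom ij.2 x.2];
     coord := fun ij x => (coord ij.1 x.1, coord ij.2 x.2) |}.

(* The patch O of chart i, which is mapped into chart j, lies inside D; in
   particular D is open. *)
Definition smooth_map (A : atlas M E) (B : atlas N F) (D : set M)
    (phi : M -> N) : Prop :=
  forall m, D m -> exists (i : idx A) (j : idx B) (O : set E),
    [/\ dom i m, open O, O (coord i m),
        (forall p, O p -> exists m',
           [/\ dom i m', coord i m' = p, D m' & dom j (phi m')]) &
        smooth O (rep i (coord j \o phi))].

(* The value does not depend on the chart i at y.1. *)
Definition tangent_map (A : atlas M E) (B : atlas N F) (phi : M -> N)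
    (y : bundle A) : bundle B :=
  (phi y.1, fun j =>
     xget 0 [set 'D_(y.2 i) (rep i (coord j \o phi)) (coord i y.1)
            | i in [set i | dom i y.1 /\ dom j (phi y.1)]]).

End Maps.

Arguments tangent_map {R M N E F} A B phi y.
Arguments smooth_map {R M N E F} A B D phi.

Definition line_atlas (R : realType) : atlas R R :=
  {| idx := unit; dom := fun=> setT; coord := fun=> id |}.

Definition tangent_atlas (R : realType) (M : Type) (E : normedModType R)
    (A : atlas M E) : atlas (bundle A) (E * E)%type :=
  {| idx := idx A;
     dom := fun i => [set y | dom i y.1 /\ tangent y.1 y.2];
     coord := fun i y => (coord i y.1, y.2 i) |}.

Record manifold (R : realType) (M : topologicalType) (E : normedModType R)
    (A : atlas M E) : Prop := {
  manifold_hausdorff : hausdorff_space M;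
  manifold_second_countable : @second_countable M;
  manifold_cover : carrier A = setT;
  manifold_dom_open : forall i : idx A, open (dom i);
  manifold_chart_inj : forall i : idx A, {in dom i &, injective (coord i)};
  manifold_chart_continuous : forall i : idx A,
    {in dom i, continuous (coord i)};
  manifold_chart_open : forall (i : idx A) (U : set M),
    open U -> U `<=` dom i -> open (coord i @` U);
  manifold_transition : forall i j : idx A,
    smooth (coord i @` (dom i `&` dom j)) (rep i (coord j)) }.

(* The compatibility between the two structures is part of lie_group below. *)
#[short(type="topologicalGroupCarrierType")]
HB.structure Definition TopologicalGroupCarrier :=
  {G of Group G & Topological G}.

Record lie_group (R : realType) (n : nat) (G : topologicalGroupCarrierType)
    (A : atlas G 'rV[R]_n) : Prop := {
  lie_group_manifold : manifold A;
  lie_group_mul : smooth_map (product_atlas A A) A setT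
    (fun xy => (xy.1 * xy.2)%g);
  lie_group_inv : smooth_map A A setT (fun x => x^-1%g) }.

Section Invariance.
Context {R : realType} {M : Type} {E : normedModType R} (A : atlas M E).
Variable op : M -> M -> M.

Definition left_invariant (X : fields A) : Prop :=
  vector_field X /\
  forall a x, carrier A a -> carrier A x ->
    tangent_map A A (op a) (x, X x) = (op a x, X (op a x)).

Definition left_invariant_metric (g : forms A) : Prop :=
  riemannian g /\
  forall a x u v, carrier A a -> carrier A x -> tangent x u -> tangent x v ->
    g (op a x) (tangent_map A A (op a) (x, u)).2
               (tangent_map A A (op a) (x, v)).2 = g x u v.

(* the tangent map of op, under the identification of T(M x M) with TM x TM *)
Definition tangent_op (y z : bundle A) : bundle A :=
  tangent_map (product_atlas A A) A
    (fun x => op x.1 x.2) ((y.1, z.1), fun ij => (y.2 ij.1, z.2 ij.2)).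

Definition derived_algebra : set (fields A) :=
  [set Z | exists (k : nat) (c : 'I_k -> R) (X Y : 'I_k -> fields A),
     [/\ forall i, left_invariant (X i), forall i, left_invariant (Y i) &
         Z = \sum_(i < k) c i *: bracket (X i) (Y i)]].

End Invariance.

Arguments tangent_op {R M E} A op y z.

Definition vertical_lift (R : realType) (M : Type) (E : normedModType R)
    (A : atlas M E) (X : fields A)
    (Z : fields (tangent_atlas A)) : Prop :=
  vector_field (A := tangent_atlas A) Z /\
  forall y (i : idx (tangent_atlas A)), dom i y ->
    is_derive (0 : R) (1 : R)
      (fun t : R => coord i (y.1, y.2 + t *: X y.1) : (E * E)%type) (Z y i).

(* phi is the flow of X for times in ]-eps, eps[ and initial points in U *)
Definition local_flow (R : realType) (M : topologicalType)
    (E : normedModType R) (A : atlas M E) (X : fields A)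
    (eps : R) (U : set M) (phi : R -> M -> M) : Prop :=
  [/\ 0 < eps, open U,
      smooth_map (product_atlas (line_atlas R) A) A
        [set tm | `|tm.1| < eps /\ U tm.2] (fun tm => phi tm.1 tm.2),
      (forall m, U m -> phi 0 m = m) &
      forall t m (i : idx A), `|t| < eps -> U m -> dom i (phi t m) ->
        is_derive t (1 : R) (fun s : R => coord i (phi s m)) (X (phi t m) i)].

Definition complete_lift (R : realType) (M : topologicalType)
    (E : normedModType R) (A : atlas M E) (X : fields A)
    (Z : fields (tangent_atlas A)) : Prop :=
  vector_field (A := tangent_atlas A) Z /\
  forall m, exists eps U phi, [/\ U m, local_flow X eps U phi &
    forall y (i : idx (tangent_atlas A)), y.1 = m -> dom i y ->
      is_derive (0 : R) (1 : R)
        (fun t : R => coord i (tangent_map A A (phi t) y) : (E * E)%type)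
        (Z y i)].

Section Lie_group.
Context {R : realType} {n : nat} {G : topologicalGroupCarrierType}.
Context (A : atlas G 'rV[R]_n).

(* the inner product induced by a left-invariant metric g on left-invariant
   fields, for which g(X,Y) is a constant function *)
Definition inner (g : forms A) (X Y : fields A) : R := g 1%g (X 1%g) (Y 1%g).

Definition orthonormal_basis (g : forms A)
    (V : set (fields A)) (e1 e2 : fields A) : Prop :=
  [/\ V e1, V e2,
      [/\ inner g e1 e1 = 1, inner g e2 e2 = 1 & inner g e1 e2 = 0] &
      forall Z, V Z -> exists c1 c2 : R, Z = c1 *: e1 + c2 *: e2].

Definition orthogonal_complement (g : forms A)
    (V : set (fields A)) : set (fields A) :=
  [set u | left_invariant *%g u /\ forall Z, V Z -> inner g u Z = 0].

Definition skew_symmetric_map (g : forms A)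
    (P : set (fields A)) (f : fields A -> fields A) : Prop :=
  [/\ forall u, P u -> P (f u),
      forall (c : R) u v, P u -> P v -> f (c *: u + v) = c *: f u + f v &
      forall u v, P u -> P v -> inner g (f u) v = - inner g u (f v)].

(* cl and vl are the complete and vertical lifts of vector fields *)
Definition lifted_metric (g : forms A)
    (cl vl : fields A -> fields (tangent_atlas A))
    (gt : forms (tangent_atlas A)) : Prop :=
  left_invariant_metric (A := tangent_atlas A) (tangent_op A *%g) gt /\
  forall X Y, left_invariant *%g X -> left_invariant *%g Y ->
  forall y, carrier (tangent_atlas A) y ->
  [/\ gt y (cl X y) (cl Y y) = g y.1 (X y.1) (Y y.1),
      gt y (vl X y) (vl Y y) = g y.1 (X y.1) (Y y.1) &
      gt y (cl X y) (vl Y y) = 0].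

End Lie_group.

(* Main.v *)
Require Import Defs.
From HB Require Import structures.
From mathcomp Require Import all_boot all_order all_algebra.
From mathcomp Require Import ring lra.
From mathcomp Require Import all_classical all_reals all_analysis.
Import Order.TTheory GRing.Theory Num.Theory.
Import numFieldNormedType.Exports.
Import Defs.
Local Open Scope classical_set_scope.
Local Open Scope ring_scope.
Set Implicit Arguments.
Unset Strict Implicit.
Unset Printing Implicit Defensive.

(** The product of two lifts of left-invariant fields is a product of
    left-invariant fields on G, or zero; it is constant, so the Koszul formula
    loses its derivative terms:
    [2 <D_X Y, Z> = <[X, Y], Z> - <[Y, Z], X> + <[Z, X], Y>]
    ([koszul_constant]). With [[X^c, Y^c] = [X, Y]^c], [[X^c, Y^v] = [X, Y]^v]
    and [[X^v, Y^v] = 0], its right-hand side reduces to structure constants of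
    the Lie algebra of G, one combination for each of the four types of pairs
    ([connection_complete_complete] and the three lemmas that follow it). A
    field on TG is determined by its products with the lifts, because the lifts
    of left-invariant fields span every tangent space of TG ([lift_span],
    [lift_product_eq]). So each formula is an identity between linear forms on
    the Lie algebra of G, which is checked on e_1, e_2 and on their orthogonal
    complement.

    Four facts feed this computation.
    - A left-invariant field takes any prescribed value at any point
      ([left_inv_exists]); it is the image of a tangent vector at 1 under left
      translations, and its smoothness comes from that of the multiplication.
    - Left-invariant fields are closed under brackets ([left_inv_bracket]), by
      the invariance of the bracket under smooth maps ([fbracket_related]).
    - In a chart the complete lift of X is [(X, D_q X)] and its vertical lift is
      [(0, X)] at the point with coordinates [(p, q)] ([complete_liftE],
      [vertical_liftE]). For the complete lift one exchanges the derivative in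
      time of the flow with its derivative in space; the bracket relations
      follow by differentiating these expressions.
    - [[e_1, e_2] = 0] ([derived_abelian]): by the Jacobi identity the trace of
      [ad X] on the derived algebra vanishes when X is itself in the derived
      algebra, and for X = e_1 and X = e_2 this trace is, up to sign, a
      coordinate of [[e_1, e_2]].

    The first three rest on the symmetry of second derivatives ([schwarz]) and
    on the product rule for the derivative of a function along a varying
    direction ([derive_along]). *)

(** * Smooth functions on normed spaces *)

Section Calculus.
Context {R : realType}.
Implicit Types U V W : normedModType R.

Lemma near_eq_differentiable V W (f g : V -> W) p :
  (\near p, f p = g p) -> differentiable f p -> differentiable g p.
Proof.
move=> fg df.
have E : g \o shift p = cst (g p) + 'd f p +o_ 0 id.
  apply/eqaddoP => e e0.
  have /eqaddoP /(_ e e0) := diff_locally df.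
  rewrite /= !near_simpl.
  have fg0 : \forall x \near (0 : V), (f \o shift p) x = (g \o shift p) x.
    rewrite /= ; move: fg; rewrite (near_shift 0 p) /=.
    by apply: filterS => x /=; rewrite subr0.
  rewrite (nbhs_singleton fg).
  move: fg0; apply: filterS2 => x /= fgx.
  by rewrite -![(_ - _ : _ -> _) _]/(_ - _) /= fgx.
apply/diff_locallyP; rewrite (diff_unique (diff_continuous df) E).
by split => //; exact: diff_continuous.
Qed.

Lemma diff_scale V W (k : V -> R) (f : V -> W) p w :
  differentiable k p -> differentiable f p ->
  differentiable (fun x => k x *: f x) p /\
  'D_w (fun x => k x *: f x) p = k p *: 'D_w f p + 'D_w k p *: f p.
Proof.
move=> dk df.
have bl : bilinear_for (GRing.Scale.Law.clone _ _ *:%R _)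
   (GRing.Scale.Law.clone _ _ *:%R _) (fun (a : R) (x : W) => a *: x).
  by split=> [x a u u'|x a u u'] /=; rewrite ?scalerDr ?scalerDl ?scalerA // mulrC.
pose blM := bilinear_isBilinear.Build _ _ _ _ _ _ _ bl.
pose s : {bilinear R -> W -> W} := HB.pack (fun (a : R) (x : W) => a *: x) blM.
have sc : continuous (fun q : R * W => s q.1 q.2) by move=> q; exact: scale_continuous.
have dp : differentiable (fun x => (k x, f x)) p by exact: differentiable_pair.
have ds := @differentiable_bilin R _ _ _ s (k p, f p) sc.
have dks : differentiable ((fun q => s q.1 q.2) \o (fun x => (k x, f x))) p.
  exact: differentiable_comp.
split; first exact: dks.
rewrite -[LHS]/('D_w ((fun q => s q.1 q.2) \o (fun x => (k x, f x))) p).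
rewrite deriveE // diff_comp // (diff_bilin (k p, f p) sc) /=.
by rewrite diff_pair //= !deriveE.
Qed.

Lemma Ck_ext V W k (A : set V) (f g : V -> W) : open A ->
  (forall p, A p -> f p = g p) -> Ck k A f -> Ck k A g.
Proof.
move=> oA; elim: k f g => [|k IH] f g fg /=.
  move=> cf p Ap; have nfg : {near p, f =1 g}.
    by near=> q; apply: fg; near: q; exact: open_nbhs_nbhs.
  apply: cvg_trans (near_eq_cvg nfg) _.
  by rewrite -(fg p Ap); exact: cf.
have nfg p : A p -> {near p, f =1 g}.
  by move=> Ap; near=> q; apply: fg; near: q; exact: open_nbhs_nbhs.
case=> df cf; split => [p Ap|w].
  exact: near_eq_differentiable (nfg p Ap) (df p Ap).
apply: IH (cf w) => p Ap; exact: near_eq_derive (nfg p Ap).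
Unshelve. all: by end_near. Qed.

Lemma Ck_sub V W k (A B : set V) (f : V -> W) :
  B `<=` A -> Ck k A f -> Ck k B f.
Proof.
move=> BA; elim: k f => [|k IH] f /=; first by move=> cf p /BA; exact: cf.
case=> df cf; split => [p /BA|w]; first exact: df.
by apply: IH; exact: cf.
Qed.

Lemma Ck_local V W k (A : set V) (f : V -> W) :
  (forall p, A p -> exists O, [/\ O p & Ck k O f]) -> Ck k A f.
Proof.
elim: k f => [|k IH] f H /=; first by move=> p /H[U [Op cf]]; exact: cf.
split => [p /H[U [Op [df _]]]|w]; first exact: df.
by apply: IH => p /H[U [Op [_ cf]]]; exists U; split=> //; exact: cf.
Qed.

Lemma CkS V W k (A : set V) (f : V -> W) : Ck k.+1 A f -> Ck k A f.
Proof.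
elim: k f => [|k IH] f /=.
  by case=> df _ p /df; exact: differentiable_continuous.
by case=> df cf; split => // w; apply: IH; exact: cf.
Qed.

Lemma Ck_cst V W k (A : set V) (c : W) : Ck k A (fun=> c).
Proof.
elim: k c => [|k IH] c /=; first by move=> p _; exact: cst_continuous.
split=> [p _|w]; first exact: differentiable_cst.
have -> : 'D_w (fun=> c) = (fun=> 0) :> (V -> W).
  by apply/funext => p; exact: derive_cst.
exact: IH.
Qed.

Lemma differentiable_idfun V (p : V) : differentiable (fun x : V => x) p.
Proof. exact: ex_diff. Qed.

Lemma Ck_idfun (V : normedModType R) n (U : set V) : Ck n U (fun x : V => x).
Proof.
case: n => [|n] /=; first by move=> p _; exact: (differentiable_continuous (differentiable_idfun p)).
split=> [p _|w]; first exact: differentiable_idfun.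
have -> : 'D_w (fun x : V => x) = (fun=> w) by apply/funext => p; exact: derive_id.
exact: Ck_cst.
Qed.

Lemma CkD V W k (A : set V) (f g : V -> W) : open A ->
  Ck k A f -> Ck k A g -> Ck k A (fun p => f p + g p).
Proof.
move=> oA; elim: k f g => [|k IH] f g /=.
  by move=> cf cg p Ap; apply: continuousD; [exact: cf|exact: cg].
case=> df cf [dg cg]; split => [p Ap|w].
  by apply: differentiableD; [exact: df|exact: dg].
apply: Ck_ext (IH _ _ (cf w) (cg w)) => // p Ap.
by rewrite -deriveD //; apply: diff_derivable; [exact: df|exact: dg].
Qed.

Lemma Ck_scale V W k (A : set V) (f : V -> R) (g : V -> W) : open A ->
  Ck k A f -> Ck k A g -> Ck k A (fun p => f p *: g p).
Proof.
move=> oA; elim: k f g => [|k IH] f g.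
  by move=> cf cg p Ap; apply: continuousZ; [exact: cf|exact: cg].
move=> Cf Cg; have [df cf] := Cf; have [dg cg] := Cg.
split => [p Ap|w]; first exact: (diff_scale 0 (df p Ap) (dg p Ap)).1.
have := CkD oA (IH _ _ (CkS Cf) (cg w)) (IH _ _ (cf w) (CkS Cg)).
apply: Ck_ext => // p Ap.
by rewrite (diff_scale w (df p Ap) (dg p Ap)).2.
Qed.

Lemma Ck_sum V W k (A : set V) n (f : 'I_n -> V -> W) : open A ->
  (forall i, Ck k A (f i)) -> Ck k A (fun p => \sum_i f i p).
Proof.
move=> oA; elim: n f => [|n IH] f cf.
  by under [X in Ck _ _ X]eq_fun do rewrite big_ord0; exact: Ck_cst.
under [X in Ck _ _ X]eq_fun do rewrite big_ord_recl.
by apply: CkD => //; apply: IH.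
Qed.

Lemma derive_lincomb V W (f : V -> W) p a u v : differentiable f p ->
  'D_(a *: u + v) f p = a *: 'D_u f p + 'D_v f p.
Proof. by move=> df; rewrite !deriveE // linearP. Qed.

(** A finite family of continuous coordinates. It turns the derivative of a
    function in a varying direction into a finite sum of functions multiplied
    by derivatives in fixed directions. *)
Definition finite_dim (V : normedModType R) : Prop :=
  exists n (l : 'I_n -> {linear V -> R}) (e : 'I_n -> V),
    (forall i, continuous (l i)) /\ forall v, v = \sum_i l i v *: e i.

Lemma finite_dim_rV n : finite_dim 'rV[R]_n.
Proof.
have lin i : linear (fun v : 'rV[R]_n => v ord0 i).
  by move=> a u v; rewrite !mxE.
pose M i := GRing.isLinear.Build R 'rV[R]_n R _ _ (lin i).
pose l i : {linear 'rV[R]_n -> R} := HB.pack (fun v : 'rV[R]_n => v ord0 i) (M i).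
exists n, l, (fun i => delta_mx ord0 i); split => [i|v].
  exact: coord_continuous.
exact: row_sum_delta.
Qed.

Lemma finite_dim_eq V (a b : V) : finite_dim V ->
  (forall l : {linear V -> R}, continuous l -> l a = l b) -> a = b.
Proof.
move=> [n [l [e [cl dec]]]] lab; apply: (eq_trans (dec a)).
apply: (eq_trans _ (esym (dec b))).
by apply: eq_bigr => i _; rewrite (lab (l i) (cl i)).
Qed.

Lemma derive_coord_sum V W n (l : 'I_n -> {linear V -> R}) (e : 'I_n -> V)
    (f : V -> W) p v :
  (forall v, v = \sum_i l i v *: e i) -> differentiable f p ->
  'D_v f p = \sum_i l i v *: 'D_(e i) f p.
Proof.
move=> dec df; rewrite deriveE // {1}(dec v) linear_sum.
by apply: eq_bigr => i _; rewrite linearZ deriveE.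
Qed.

Lemma derive_comp U V W (f : U -> V) (g : V -> W) p w :
  differentiable f p -> differentiable g (f p) ->
  'D_w (g \o f) p = 'D_('D_w f p) g (f p).
Proof.
move=> df dg; rewrite deriveE; last exact: differentiable_comp.
by rewrite diff_comp //= !deriveE.
Qed.

Lemma derive_linear_comp U V W (f : U -> V) (l : {linear V -> W}) p w :
  continuous l -> differentiable f p ->
  differentiable (l \o f) p /\ 'D_w (l \o f) p = l ('D_w f p).
Proof.
move=> cl df; have dl q := linear_differentiable q cl.
split; first exact: differentiable_comp.
by rewrite derive_comp // deriveE // diff_lin.
Qed.

Lemma Ck_linear_comp U V W k (A : set U) (f : U -> V) (l : {linear V -> W}) :
  open A -> continuous l -> Ck k A f -> Ck k A (l \o f).
Proof.
move=> oA cl; elim: k f => [|k IH] f /=.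
  by move=> cf p Ap; apply: continuous_comp; [exact: cf|exact: cl].
case=> df cf; split => [p Ap|w].
  exact: (derive_linear_comp 0 cl (df p Ap)).1.
apply: Ck_ext (IH _ (cf w)) => // p Ap /=.
by rewrite (derive_linear_comp w cl (df p Ap)).2.
Qed.

(** By the chain rule the derivative of [g \o f] along w is the sum over i of
    [l_i (D_w f) * (D_(e_i) g \o f)], whose terms are of class C^k by induction. *)
Lemma Ck_comp U V W k (A : set U) (B : set V) f (g : V -> W) : finite_dim V ->
  open A -> (forall p, A p -> B (f p)) ->
  Ck k A f -> Ck k B g -> Ck k A (g \o f).
Proof.
move=> [n [l [e [cl dec]]]] oA AB; elim: k f g AB => [|k IH] f g AB.
  by move=> cf cg p Ap; apply: continuous_comp; [exact: cf|exact/cg/AB].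
move=> Cf Cg; have [df cf] := Cf; have [dg cg] := Cg.
split => [p Ap|w].
  by apply: differentiable_comp; [exact: df|exact/dg/AB].
have H : Ck k A (fun p => \sum_i l i ('D_w f p) *: 'D_(e i) g (f p)).
  apply: Ck_sum => // i; apply: Ck_scale => //.
    apply: (@Ck_linear_comp _ _ _ _ _ ('D_w f) (l i)) => //; exact: cf.
  exact: (IH _ ('D_(e i) g) AB (CkS Cf) (cg _)).
apply: Ck_ext H => // p Ap.
rewrite derive_comp //; [|exact: df|exact/dg/AB].
by rewrite -(derive_coord_sum _ dec) //; exact/dg/AB.
Qed.

End Calculus.

(** * Symmetry of second derivatives *)

Section Schwarz.
Context {R : realType}.
Implicit Types U V W : normedModType R.

Lemma is_derive_line V W (f : V -> W) a u s : differentiable f (a + s *: u) ->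
  is_derive s (1 : R) (fun t => f (a + t *: u)) ('D_u f (a + s *: u)).
Proof.
move=> df.
have E : (fun h : R => h^-1 *: (((fun t => f (a + t *: u)) \o shift s) (h *: 1)
                       - f (a + s *: u)))
  = (fun h => h^-1 *: ((f \o shift (a + s *: u)) (h *: u) - f (a + s *: u))).
  apply/funext => h /=; rewrite [h *: 1]mulr1 scalerDl addrA (addrC a) -addrA.
  by [].
split; first by rewrite /derivable E; exact: diff_derivable.
by rewrite /derive E.
Qed.

Lemma mean_value_line V (f : V -> R) a u (h : R) : 0 < h ->
  (forall s, 0 <= s <= h -> differentiable f (a + s *: u)) ->
  exists2 s, 0 < s < h & f (a + h *: u) - f a = h * 'D_u f (a + s *: u).
Proof.
move=> h0 df.
have der s : 0 <= s <= h ->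
    is_derive s (1 : R) (fun t => f (a + t *: u)) ('D_u f (a + s *: u)).
  by move=> /df; exact: is_derive_line.
have [||s sh] := @MVT R (fun t => f (a + t *: u))
  (fun t => 'D_u f (a + t *: u)) 0 h h0.
- by move=> s; rewrite in_itv /= => /andP[s0 sh]; apply: der; rewrite !ltW.
- apply: derivable_within_continuous => s; rewrite in_itv /= => sh.
  by have [] := der _ sh.
- rewrite scale0r addr0 subr0 mulrC => E; exists s => //.
Qed.

(** The mean value theorem, applied first in the direction u to the difference
    of f between two parallel sides of the parallelogram, then in the direction
    v to [D_u f]. *)
Lemma mixed_mean_value V (f : V -> R) (A : set V) p u v (h : R) : 0 < h ->
  (forall s t, 0 <= s <= h -> 0 <= t <= h -> A (p + s *: u + t *: v)) ->
  Ck 2 A f ->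
  exists s t, [/\ 0 < s < h, 0 < t < h &
    f (p + h *: u + h *: v) - f (p + h *: u) - (f (p + h *: v) - f p)
    = h * (h * 'D_v ('D_u f) (p + s *: u + t *: v))].
Proof.
move=> h0 Ah [df cf].
have hh : 0 <= h <= h by rewrite lexx ltW.
have oo : 0 <= (0 : R) <= h by rewrite lexx ltW.
have Ah0 s : 0 <= s <= h -> A (p + s *: u).
  by move=> sh; have := Ah s 0 sh oo; rewrite scale0r addr0.
pose g q := f (q + h *: v) - f q.
have dsh (k : V -> R) q : differentiable k (q + h *: v) ->
    differentiable (fun q => k (q + h *: v)) q.
  by move=> dk; apply: (@differentiable_comp _ _ _ _ (fun q => q + h *: v)).
have dg s : 0 <= s <= h -> differentiable g (p + s *: u).
  move=> sh; apply: differentiableB; last exact/df/Ah0.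
  by apply: dsh; apply/df/Ah.
have [s sh E] := mean_value_line h0 dg.
have sh' : 0 <= s <= h by case/andP: sh => *; rewrite !ltW.
have [t0 th E2] := @mean_value_line _ ('D_u f) (p + s *: u) v h h0
  (fun t th => (cf u).1 _ (Ah s t sh' th)).
exists s, t0; split => //; rewrite -E2.
transitivity (g (p + h *: u) - g p) => //.
rewrite E; congr (_ * _); rewrite /g.
have -> : (fun q => f (q + h *: v) - f q) = (fun q => f (q + h *: v)) - f by [].
rewrite deriveB; last 2 first.
- by apply/diff_derivable/dsh/df/Ah.
- by apply/diff_derivable/df/Ah0.
apply: (f_equal (fun t => t - 'D_u f (p + s *: u))); rewrite /derive.
have -> : (fun k : R => k^-1 *: (((fun q => f (q + h *: v)) \o shift (p + s *: u))
       (k *: u) - f (p + s *: u + h *: v)))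
 = (fun k : R => k^-1 *: ((f \o shift (p + s *: u + h *: v)) (k *: u)
     - f (p + s *: u + h *: v))); last by [].
by apply/funext => k /=; rewrite -(addrA (k *: u) (p + s *: u)).
Qed.

Lemma nbhs_parallelogram V (p u v : V) (P : set V) : nbhs p P ->
  exists2 h : R, 0 < h &
    forall s t, 0 <= s <= h -> 0 <= t <= h -> P (p + s *: u + t *: v).
Proof.
move=> /nbhs_ballP[r /= r0 rP].
have n0 : 0 < `|u| + `|v| + 1 by rewrite ltr_wpDl // addr_ge0.
exists (r / (`|u| + `|v| + 1)); first by rewrite divr_gt0.
move=> s t /andP[s0 sh] /andP[t0 th]; apply: rP.
rewrite -ball_normE /ball_ /= -addrA opprD addNKr normrN.
apply: (le_lt_trans (ler_normD _ _)); rewrite !normrZ (ger0_norm s0) (ger0_norm t0).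
apply: (le_lt_trans (lerD (ler_wpM2r _ sh) (ler_wpM2r _ th))) => //.
by rewrite -mulrDr mulrAC ltr_pdivrMr // ltr_pM2l // ltrDl.
Qed.

(** The second difference of f over a small parallelogram is symmetric in u and
    v, and is h^2 times a value of either mixed derivative near p; both of these
    are continuous. *)
Lemma schwarz_scalar V (f : V -> R) (A : set V) p u v : open A -> A p ->
  Ck 2 A f -> 'D_u ('D_v f) p = 'D_v ('D_u f) p.
Proof.
move=> oA Ap Cf; have [_ cf] := Cf.
have c1 : {for p, continuous ('D_u ('D_v f))} := (cf v).2 u p Ap.
have c2 : {for p, continuous ('D_v ('D_u f))} := (cf u).2 v p Ap.
apply/eqP; rewrite -subr_eq0 -normr_le0; apply/ler_addgt0Pl => e e0.
rewrite addr0.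
have e2 : 0 < e / 2 by rewrite divr_gt0.
have n1 : \forall q \near p, `|'D_u ('D_v f) p - 'D_u ('D_v f) q| < e / 2.
  by move/cvgrPdist_lt : c1; apply.
have n2 : \forall q \near p, `|'D_v ('D_u f) p - 'D_v ('D_u f) q| < e / 2.
  by move/cvgrPdist_lt : c2; apply.
have [h h0 H] := nbhs_parallelogram u v
  (filterI (filterI (open_nbhs_nbhs (conj oA Ap)) n1) n2).
have [s [t [/andP[s0 sh] /andP[t0 th] E1]]] :=
  mixed_mean_value h0 (fun s t S T => (H s t S T).1.1) Cf.
have [|t' [s' [/andP[t'0 t'h] /andP[s'0 s'h] E2]]] :=
  @mixed_mean_value _ f A p v u h h0 _ Cf.
  by move=> s' t' S T; rewrite addrAC; exact: (H t' s' T S).1.1.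
have E : 'D_u ('D_v f) (p + s' *: u + t' *: v)
       = 'D_v ('D_u f) (p + s *: u + t *: v).
  apply: (mulfI (lt0r_neq0 h0)); apply: (mulfI (lt0r_neq0 h0)).
  rewrite (addrAC p (s' *: u)); apply: (eq_trans (esym E2)).
  apply: eq_trans E1; rewrite (addrAC p (h *: v)).
  have swap (a b x y : R) : a - b - (x - y) = a - x - (b - y) by ring.
  exact: swap.
have B1 := (H s' t' _ _).1.2; have B2 := (H s t _ _).2.
rewrite -(subrKA ('D_u ('D_v f) (p + s' *: u + t' *: v))).
apply: (le_trans (ler_normD _ _)); rewrite (splitr e); apply: lerD.
  by apply/ltW/B1; rewrite !ltW.
by rewrite E distrC; apply/ltW/B2; rewrite !ltW.
Qed.

Lemma schwarz V W (f : V -> W) (A : set V) p u v : finite_dim W ->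
  open A -> A p -> Ck 2 A f -> 'D_u ('D_v f) p = 'D_v ('D_u f) p.
Proof.
move=> fW oA Ap Cf; have [df cf] := Cf; apply: (finite_dim_eq fW) => l cl.
have D a b : l ('D_a ('D_b f) p) = 'D_a ('D_b (l \o f)) p.
  rewrite -(derive_linear_comp a cl ((cf b).1 p Ap)).2; apply: near_eq_derive.
  have := open_nbhs_nbhs (conj oA Ap); apply: filterS => q Aq /=.
  by rewrite (derive_linear_comp b cl (df q Aq)).2.
apply: (eq_trans (D u v)); apply: (eq_trans _ (esym (D v u))).
exact: (schwarz_scalar _ _ oA Ap (Ck_linear_comp oA cl Cf)).
Qed.

End Schwarz.

(** * Derivatives along fields, and brackets in coordinates *)

Section LocalFields.
Context {R : realType}.
Implicit Types V W U : normedModType R.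

(** Difference quotients along a line are those along its image by the affine
    map j, so f may be arbitrary. *)
Lemma derive_affine V W U (j l : V -> W) (f : W -> U) p w :
  (forall (h : R) u q, j (h *: u + q) = h *: l u + j q) ->
  'D_w (f \o j) p = 'D_(l w) f (j p).
Proof.
by move=> jl; rewrite /derive /=; congr (lim _);
  under [X in X @ _ = _]eq_fun do rewrite jl.
Qed.

Lemma Ck_affine V W U k (A : set W) (j l : V -> W) (f : W -> U) :
  (forall (h : R) u q, j (h *: u + q) = h *: l u + j q) ->
  (forall p, differentiable j p) ->
  Ck k A f -> Ck k (j @^-1` A) (f \o j).
Proof.
move=> jl dj; elim: k f => [|k IH] f.
  move=> cf p Ap; apply: continuous_comp; last exact: cf.
  exact: differentiable_continuous.
case=> df cf; split => [p Ap|w].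
  by apply: differentiable_comp => //; exact: df.
have -> : 'D_w (f \o j) = 'D_(l w) f \o j.
  by apply/funext => p /=; exact: derive_affine.
by apply: IH; exact: cf.
Qed.

Lemma near_open V (A : set V) p : open A -> A p -> \forall q \near p, A q.
Proof. by move=> oA Ap; exact: open_nbhs_nbhs. Qed.

Lemma Ck_along U V W k (A : set U) (B : set V)
    (X f : U -> V) (Y : V -> W) : finite_dim V ->
  open A -> (forall p, A p -> B (f p)) -> Ck k A X -> Ck k A f ->
  Ck k.+1 B Y -> Ck k A (fun p => 'D_(X p) Y (f p)).
Proof.
move=> fV oA AB cX cf [dY cY]; have [n [l [e [cl dec]]]] := fV.
have H : Ck k A (fun p => \sum_i l i (X p) *: 'D_(e i) Y (f p)).
  apply: Ck_sum => // i; apply: Ck_scale => //.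
    exact: (Ck_linear_comp oA (cl i) cX).
  exact: (Ck_comp fV oA AB cf (cY (e i))).
apply: Ck_ext H => // p Ap; rewrite -(derive_coord_sum _ dec) //.
exact/dY/AB.
Qed.

Lemma diff_sum V W n (f : 'I_n -> V -> W) p w :
  (forall i, differentiable (f i) p) ->
  differentiable (fun q => \sum_i f i q) p /\
  'D_w (fun q => \sum_i f i q) p = \sum_i 'D_w (f i) p.
Proof.
move=> df.
have -> : (fun q => \sum_i f i q) = \sum_i f i.
  by apply/funext => q; rewrite fct_sumE.
split; first exact: differentiable_sum.
by apply: derive_sum => i; exact: diff_derivable.
Qed.

(** The product rule for [D_(X q) Y (f q)], which is bilinear in X and Y. The
    second derivative of Y appears as [D_w' (D_(X p) Y)] with [X p] frozen, the
    symmetry of second derivatives giving the order of differentiation. *)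
Lemma derive_along U V W (A : set V) (X f : U -> V) (Y : V -> W) p w :
  finite_dim V -> finite_dim W ->
  open A -> A (f p) -> differentiable X p -> differentiable f p -> Ck 2 A Y ->
  differentiable (fun q => 'D_(X q) Y (f q)) p /\
  'D_w (fun q => 'D_(X q) Y (f q)) p
  = 'D_('D_w X p) Y (f p) + 'D_('D_w f p) ('D_(X p) Y) (f p).
Proof.
move=> fV fW oA Ap dX df CY; have [n [l [e [cl dec]]]] := fV.
have [dY cY] := CY.
have E : \forall q \near p, \sum_i l i (X q) *: 'D_(e i) Y (f q) = 'D_(X q) Y (f q).
  have : \forall q \near p, A (f q).
    by apply: (differentiable_continuous df); exact: (open_nbhs_nbhs (conj oA Ap)).
  by apply: filterS => q Aq; rewrite -(derive_coord_sum _ dec) //; exact: dY.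
have D i : differentiable (fun q => 'D_(e i) Y (f q)) p.
  exact: (differentiable_comp df ((cY (e i)).1 _ Ap)).
have L i := derive_linear_comp w (cl i) dX.
have S i := diff_scale w (L i).1 (D i).
have [S1 S2] := diff_sum w (fun i => (S i).1).
split; first exact: near_eq_differentiable E S1.
rewrite -(near_eq_derive w E) S2.
under eq_bigr do rewrite (S _).2 (L _).2.
rewrite big_split /= addrC; apply: (f_equal2 (fun a b => a + b)).
  exact: (esym (derive_coord_sum _ dec (dY _ Ap))).
apply: (eq_trans _ (schwarz (X p) ('D_w f p) fW oA Ap CY)).
apply: (eq_trans _ (esym (derive_coord_sum (X p) dec ((cY _).1 _ Ap)))).
apply: eq_bigr => i _; apply: (f_equal (fun t => _ *: t)).
apply: (eq_trans (derive_comp w df ((cY _).1 _ Ap))).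
exact: (schwarz _ _ fW oA Ap CY).
Qed.

(** The Lie bracket in a chart. *)
Definition fbracket V (X Y : V -> V) q := 'D_(X q) Y q - 'D_(Y q) X q.

Lemma deriveBl V W (f : V -> W) p u v : differentiable f p ->
  'D_(u - v) f p = 'D_u f p - 'D_v f p.
Proof. by move=> df; rewrite !deriveE // linearB. Qed.

(** Differentiating [X' \o f = D_X f] along Y gives the second derivative of f
    and two first-order terms; the second derivatives cancel in the bracket. *)
Lemma fbracket_related V W (f : V -> W) (A : set V) p
    (X Y : V -> V) (X' Y' : W -> W) : finite_dim V -> finite_dim W ->
  open A -> A p -> Ck 2 A f -> differentiable X p -> differentiable Y p ->
  differentiable X' (f p) -> differentiable Y' (f p) ->
  (\forall q \near p, X' (f q) = 'D_(X q) f q) ->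
  (\forall q \near p, Y' (f q) = 'D_(Y q) f q) ->
  'D_(fbracket X Y p) f p = fbracket X' Y' (f p).
Proof.
move=> fV fW oA Ap Cf dX dY dX' dY' eX eY; have df := Cf.1 _ Ap.
have rel (Z T : V -> V) T' : differentiable T p ->
    differentiable T' (f p) ->
    (\forall q \near p, T' (f q) = 'D_(T q) f q) ->
    'D_('D_(Z p) f p) T' (f p)
    = 'D_('D_(Z p) T p) f p + 'D_(Z p) ('D_(T p) f) p.
  move=> dT dT' eT.
  have [_] := derive_along (Z p) fV fW oA Ap dT (differentiable_idfun p) Cf.
  rewrite derive_id => <-; apply: (eq_trans (esym (derive_comp _ df dT'))).
  exact: near_eq_derive eT.
rewrite /fbracket (nbhs_singleton eX) (nbhs_singleton eY).
rewrite (rel X Y Y' dY dY' eY) (rel Y X X' dX dX' eX).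
rewrite (deriveBl _ _ df) (schwarz (Y p) (X p) fW oA Ap Cf).
have cancel (a b x : W) : a - b = a + x - (b + x).
  by rewrite opprD addrACA subrr addr0.
exact: cancel.
Qed.

Lemma derive_fbracket V (X Y : V -> V) (A : set V) p w : finite_dim V ->
  open A -> A p -> Ck 2 A X -> Ck 2 A Y ->
  'D_w (fbracket X Y) p =
   ('D_('D_w X p) Y p + 'D_w ('D_(X p) Y) p)
   - ('D_('D_w Y p) X p + 'D_w ('D_(Y p) X) p).
Proof.
move=> fV oA Ap CX CY; have dX := CX.1 _ Ap; have dY := CY.1 _ Ap.
have H (Z T : V -> V) : differentiable Z p -> Ck 2 A T ->
   differentiable (fun q => 'D_(Z q) T q) p /\
   'D_w (fun q => 'D_(Z q) T q) p = 'D_('D_w Z p) T p + 'D_w ('D_(Z p) T) p.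
  move=> dZ CT.
  have := derive_along w fV fV oA Ap dZ (differentiable_idfun p) CT.
  by rewrite derive_id.
have [d1 E1] := H X Y dX CY; have [d2 E2] := H Y X dY CX.
by rewrite -E1 -E2 -deriveB //; exact: diff_derivable.
Qed.

(** All terms with second derivatives of X, Y or Z cancel by symmetry, and those
    with two first derivatives cancel in pairs. *)
Lemma fbracket_jacobi V (X Y Z : V -> V) (A : set V) p : finite_dim V ->
  open A -> A p -> Ck 2 A X -> Ck 2 A Y -> Ck 2 A Z ->
  fbracket (fbracket X Y) Z p =
  fbracket X (fbracket Y Z) p - fbracket Y (fbracket X Z) p.
Proof.
move=> fV oA Ap CX CY CZ.
have dX := CX.1 _ Ap; have dY := CY.1 _ Ap; have dZ := CZ.1 _ Ap.
have B S T w (CS : Ck 2 A S) (CT : Ck 2 A T) := derive_fbracket w fV oA Ap CS CT.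
have sY := schwarz (X p) (Z p) fV oA Ap CY.
have sX := schwarz (Y p) (Z p) fV oA Ap CX.
have sZ := schwarz (X p) (Y p) fV oA Ap CZ.
have -> : fbracket (fbracket X Y) Z p
  = ('D_('D_(X p) Y p) Z p - 'D_('D_(Y p) X p) Z p)
    - ('D_('D_(Z p) X p) Y p + 'D_(Z p) ('D_(X p) Y) p
       - ('D_('D_(Z p) Y p) X p + 'D_(Z p) ('D_(Y p) X) p)).
  by rewrite /fbracket -/(fbracket X Y) (B _ _ _ CX CY) (deriveBl _ _ dZ).
have -> : fbracket X (fbracket Y Z) p
  = 'D_('D_(X p) Y p) Z p + 'D_(X p) ('D_(Y p) Z) p
    - ('D_('D_(X p) Z p) Y p + 'D_(X p) ('D_(Z p) Y) p)
    - ('D_('D_(Y p) Z p) X p - 'D_('D_(Z p) Y p) X p).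
  by rewrite /fbracket -/(fbracket Y Z) (B _ _ _ CY CZ) (deriveBl _ _ dX).
have -> : fbracket Y (fbracket X Z) p
  = 'D_('D_(Y p) X p) Z p + 'D_(Y p) ('D_(X p) Z) p
    - ('D_('D_(Y p) Z p) X p + 'D_(Y p) ('D_(Z p) X) p)
    - ('D_('D_(X p) Z p) Y p - 'D_('D_(Z p) X p) Y p).
  by rewrite /fbracket -/(fbracket X Z) (B _ _ _ CX CZ) (deriveBl _ _ dY).
rewrite sX sY sZ.
have alg (a b c d e f g h k : V) :
    (a - b) - (c + d - (e + f)) =
    a + g - (h + d) - (k - e) - (b + g - (k + f) - (h - c)).
  by apply: (finite_dim_eq fV) => l _; rewrite !(linearB, linearD) /=; ring.
exact: alg.
Qed.

Lemma derive_pair V W U (f : V -> W) (g : V -> U) p w :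
  differentiable f p -> differentiable g p ->
  'D_w (fun x => (f x, g x)) p = ('D_w f p, 'D_w g p).
Proof.
move=> df dg; rewrite deriveE; last exact: differentiable_pair.
by rewrite diff_pair //= !deriveE.
Qed.

Lemma derive_linear V W (l : {linear V -> W}) p w : continuous l ->
  differentiable l p /\ 'D_w l p = l w.
Proof.
move=> cl; have dl := linear_differentiable p cl.
by split => //; rewrite deriveE // diff_lin.
Qed.

Lemma derive_fst V W (p w : V * W) :
  differentiable (@fst V W) p /\ 'D_w (@fst V W) p = w.1.
Proof. by apply: derive_linear => q; exact: cvg_fst. Qed.

Lemma derive_snd V W (p w : V * W) :
  differentiable (@snd V W) p /\ 'D_w (@snd V W) p = w.2.
Proof. by apply: derive_linear => q; exact: cvg_snd. Qed.

Lemma derive_comp_fst V W U (Y : V -> U) (p w : V * W) :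
  differentiable Y p.1 ->
  differentiable (fun pq : V * W => Y pq.1) p /\
  'D_w (fun pq : V * W => Y pq.1) p = 'D_(w.1) Y p.1.
Proof.
move=> dY; have [d1 E1] := derive_fst p w.
split; first exact: (differentiable_comp d1 dY).
by rewrite (derive_comp w d1 dY) E1.
Qed.

(** [(p, q) |-> (Y p, D_q Y p)] is the tangent map of Y. It is the local form of
    complete lifts, with Y a field, and of the transition maps of the tangent
    bundle, with Y a transition map. *)
Lemma derive_tangent_lift V W (Y : V -> W) (A : set V) p q a b :
  finite_dim V -> finite_dim W -> open A -> A p -> Ck 2 A Y ->
  'D_(a, b) (fun pq : V * V => (Y pq.1, 'D_(pq.2) Y pq.1)) (p, q)
  = ('D_a Y p, 'D_a ('D_q Y) p + 'D_b Y p).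
Proof.
move=> fV fW oA Ap CY.
have [d1 E1] := derive_fst (p, q) (a, b).
have [d2 E2] := derive_snd (p, q) (a, b).
have [dY EY] := @derive_comp_fst _ _ _ Y (p, q) (a, b) (CY.1 _ Ap).
have [dA EA] := derive_along (a, b) fV fW oA (Ap : A (p, q).1) d2 d1 CY.
by rewrite (derive_pair _ dY dA) EY EA E1 E2 addrC.
Qed.

Lemma derive_vertical_lift V W (Y : V -> W) (p q a b : V) : differentiable Y p ->
  'D_(a, b) (fun pq : V * V => (0 : W, Y pq.1)) (p, q) = (0, 'D_a Y p).
Proof.
move=> dY; have [d E] := @derive_comp_fst _ V _ Y (p, q) (a, b) dY.
have d0 : differentiable (fun=> 0 : W) (p, q) by exact: differentiable_cst.
by rewrite (derive_pair _ d0 d) E derive_cst.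
Qed.

End LocalFields.

(** * Atlases and their transition maps *)

Section Charts.
Context {R : realType}.
Implicit Types E F : normedModType R.

Lemma open_preimage (V W : normedModType R) (f : V -> W) (A : set V) (B : set W) :
  open A -> (forall p, A p -> {for p, continuous f}) -> open B ->
  open (A `&` f @^-1` B).
Proof.
move=> oA cf oB; rewrite openE => p [Ap Bfp].
apply: filterI; first exact: (open_nbhs_nbhs (conj oA Ap)).
by apply: (cf p Ap); exact: (open_nbhs_nbhs (conj oB Bfp)).
Qed.

Definition injective_charts M E (A : atlas M E) := forall (i : idx A) x y,
  dom i x -> dom i y -> coord i x = coord i y -> x = y.

Lemma rep_coord M E F (A : atlas M E) (i : idx A) (h : M -> F) m :
  injective_charts A -> dom i m -> rep i h (coord i m) = h m.
Proof.
move=> inj im; apply: xget_unique; first by exists m.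
by move=> _ [m' /= [im' E'] <-]; congr h; exact: inj E'.
Qed.

Lemma injective_line : injective_charts (line_atlas R).
Proof. by []. Qed.

Lemma injective_product M N E F (A : atlas M E) (B : atlas N F) :
  injective_charts A -> injective_charts B -> injective_charts (product_atlas A B).
Proof.
move=> iA iB [i j] [x x'] [y y'] /= [ix jx'] [iy jy'] [e e'].
by rewrite (iA i x y) // (iB j x' y').
Qed.

Lemma injective_manifold (M : topologicalType) E (A : atlas M E) :
  manifold A -> injective_charts A.
Proof.
move=> hA i x y ix iy e.
by apply: (manifold_chart_inj hA (i := i)) e; rewrite inE.
Qed.

(** phi is smooth on the patch O of the chart i, which it sends into the chart
    j. *)
Definition smooth_rep M N E F (A : atlas M E) (B : atlas N F) (phi : M -> N)
    (i : idx A) (j : idx B) (O : set E) : Prop :=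
  [/\ open O,
     forall p, O p -> exists m', [/\ dom i m', coord i m' = p & dom j (phi m')] &
     smooth O (rep i (coord j \o phi))].

(** Fixing the first argument: applied to the multiplication of a group this
    gives left translations, and to a flow the map at a fixed time. *)
Lemma slice_product M N P E F F' (A : atlas M E) (B : atlas N F) (C : atlas P F')
    (phi : M * N -> P) i k j O a : injective_charts A -> injective_charts B ->
  smooth_rep (A := product_atlas A B) (B := C) phi (i, k) j O -> dom i a ->
  smooth_rep (A := B) (B := C) (fun x => phi (a, x)) k j
    [set p | O (coord i a, p)].
Proof.
move=> iA iB [oO img sm] ia.
have iAB := injective_product iA iB.
pose jj (p : F) : E * F := (coord i a, p); pose ll (p : F) : E * F := (0, p).
have jl (h : R) u q : jj (h *: u + q) = h *: ll u + jj q.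
  by rewrite -[RHS]/(h *: 0 + coord i a, h *: u + q) scaler0 add0r.
have dj p : differentiable jj p by apply: differentiable_pair; exact: ex_diff.
have oS : open [set p | O (coord i a, p)].
  rewrite -[X in open X](setTI (jj @^-1` O)); apply: open_preimage => //.
    exact: openT.
  by move=> p _; exact: differentiable_continuous.
have img' p : O (coord i a, p) ->
    exists2 m', dom k m' /\ coord k m' = p & dom j (phi (a, m')).
  move=> /img[[m1 m2] /= [[im1 km2] [e1 e2] jm]]; exists m2 => //.
  by rewrite -(iA i m1 a).
split => //.
  by move=> p /img'[m' [? ?] ?]; exists m'.
move=> n; have := Ck_affine jl dj (sm n); apply: Ck_ext => // p.
move=> /img'[m' [km' <-] jm'].
rewrite (rep_coord _ iB km') /=.
by rewrite -[jj (coord k m')]/(@coord _ _ _ (product_atlas A B) (i, k) (a, m')) rep_coord.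
Qed.

Section Manifold.
Context {M : topologicalType} {E : normedModType R} (A : atlas M E).
Hypotheses (fE : finite_dim E) (hA : manifold A).
Implicit Types (i j k : idx A) (m : M).

Let iA : injective_charts A := injective_manifold hA.

Definition overlap i j : set E := coord i @` (dom i `&` dom j).

Lemma open_overlap i j : open (overlap i j).
Proof.
apply: (manifold_chart_open hA); last by move=> x [].
by apply: openI; exact: manifold_dom_open.
Qed.

Lemma open_chart_image i : open (chart_image i).
Proof. by apply: (manifold_chart_open hA) => //; exact: manifold_dom_open. Qed.

Lemma in_chart m : exists i, dom i m.
Proof.
have : carrier A m by rewrite (manifold_cover hA).
by case=> i _ im; exists i.
Qed.

Lemma transition_smooth i j : smooth (overlap i j) (rep i (coord j)).
Proof. exact: manifold_transition. Qed.

Lemma transition_coord i j m : dom i m -> rep i (coord j) (coord i m) = coord j m.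
Proof. by move=> im; rewrite rep_coord. Qed.

Lemma overlap_coord i j m : dom i m -> dom j m -> overlap i j (coord i m).
Proof. by move=> im jm; exists m. Qed.

Lemma overlapP i j p : overlap i j p ->
  exists m, [/\ dom i m, dom j m & coord i m = p].
Proof. by case=> m [im jm] <-; exists m. Qed.

Lemma transition_diff i j m : dom i m -> dom j m ->
  differentiable (rep i (coord j)) (coord i m).
Proof. by move=> im jm; apply: (transition_smooth i j 1).1; exact: overlap_coord. Qed.

Lemma transition_continuous i j p : overlap i j p ->
  {for p, continuous (rep i (coord j))}.
Proof. exact: (transition_smooth i j 0). Qed.

Lemma near_overlap i j m : dom i m -> dom j m ->
  \forall p \near coord i m, overlap i j p.
Proof.
by move=> im jm; apply: near_open; [exact: open_overlap|exact: overlap_coord].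
Qed.

Lemma near_chart_image i m : dom i m -> \forall p \near coord i m, chart_image i p.
Proof.
by move=> im; apply: near_open; [exact: open_chart_image|exists m].
Qed.

Lemma rep_change F (h : M -> F) i j p : overlap i j p ->
  rep i h p = rep j h (rep i (coord j) p).
Proof.
by move=> /overlapP[m [im jm <-]]; rewrite transition_coord // !rep_coord.
Qed.

(** The chain rule for [h = (h \o coord_j^-1) \o (coord_j \o coord_i^-1)]. *)
Lemma derive_change F (h : M -> F) i j m v : dom i m -> dom j m ->
  differentiable (rep j h) (coord j m) ->
  differentiable (rep i h) (coord i m) /\
  'D_v (rep i h) (coord i m)
  = 'D_('D_v (rep i (coord j)) (coord i m)) (rep j h) (coord j m).
Proof.
move=> im jm dh.
have ch : \forall p \near coord i m, (rep j h \o rep i (coord j)) p = rep i h p.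
  by have := near_overlap im jm; apply: filterS => p ov; rewrite /= -rep_change.
have dt := transition_diff im jm.
have dh' : differentiable (rep j h) (rep i (coord j) (coord i m)).
  by rewrite transition_coord.
split; first exact: near_eq_differentiable ch (differentiable_comp dt dh').
rewrite -(near_eq_derive v ch) (derive_comp v dt dh').
by rewrite transition_coord.
Qed.

Lemma derive_chart F (h : M -> F) i j m v : tangent (A := A) m v ->
  dom i m -> dom j m -> differentiable (rep j h) (coord j m) ->
  'D_(v i) (rep i h) (coord i m) = 'D_(v j) (rep j h) (coord j m).
Proof.
by move=> [_ tv] im jm dh; rewrite (derive_change _ im jm dh).2 -(tv i j).
Qed.

Lemma derive_transition_id i m v : dom i m -> 'D_v (rep i (coord i)) (coord i m) = v.
Proof.
move=> im; rewrite -[RHS](derive_id (coord i m) v); apply: near_eq_derive.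
have := near_chart_image im; apply: filterS => p [m' im' <-].
by rewrite rep_coord.
Qed.

Lemma tangent_eq m u v i : tangent (A := A) m u -> tangent (A := A) m v ->
  dom i m -> u i = v i -> u = v.
Proof.
move=> [u0 tu] [v0 tv] im e; apply/funext => j.
have [jm|jm] := pselect (dom j m); last by rewrite u0 // v0.
by rewrite (tu i j) // (tv i j) // e.
Qed.

Lemma tangent_exists m i q : dom i m -> exists2 v, tangent (A := A) m v & v i = q.
Proof.
move=> im.
pose v j := if `[< dom j m >] then 'D_q (rep i (coord j)) (coord i m) else 0.
have vE j : dom j m -> v j = 'D_q (rep i (coord j)) (coord i m).
  by move=> jm; rewrite /v asboolT.
exists v; last by rewrite vE // derive_transition_id.
split=> [j jm|j k jm km]; first by rewrite /v asboolF.
rewrite !vE //.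
exact: (derive_change _ im jm (transition_diff jm km)).2.
Qed.

Lemma tangent_lincomb m (a : R) u v :
  tangent (A := A) m u -> tangent (A := A) m v -> tangent (A := A) m (a *: u + v).
Proof.
move=> [u0 tu] [v0 tv]; split=> [i im|i j im jm].
  have -> : (a *: u + v) i = a *: u i + v i by [].
  by rewrite u0 // v0 // scaler0 addr0.
have E' k : (a *: u + v) k = a *: u k + v k by [].
rewrite !E' derive_lincomb; last exact: transition_diff.
by rewrite (tu i j) // (tv i j).
Qed.

Lemma tangent0 m : tangent (A := A) m 0.
Proof.
split=> // i j im jm.
have E' k : (0 : idx A -> E) k = 0 by [].
by rewrite !E' derive0.
Qed.

Lemma Ck_rep_change (F : normedModType R) (h : M -> F) i j m n O : dom i m -> dom j m ->
  open O -> O (coord j m) -> Ck n O (rep j h) ->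
  exists O', [/\ open O', O' (coord i m) & Ck n O' (rep i h)].
Proof.
move=> im jm oO Om Ch; pose t := rep i (coord j).
have tm : t (coord i m) = coord j m by rewrite /t rep_coord.
have oO' : open (overlap i j `&` t @^-1` O).
  apply: open_preimage => //; first exact: open_overlap.
  exact: transition_continuous.
exists (overlap i j `&` t @^-1` O); split => //.
  by split=> /=; [exact: overlap_coord|rewrite tm].
have Ct : Ck n (overlap i j `&` t @^-1` O) t.
  by apply: Ck_sub (transition_smooth i j n) => p [].
have Op p : (overlap i j `&` t @^-1` O) p -> O (t p) by case.
apply: (Ck_ext oO' _ (Ck_comp fE oO' Op Ct Ch)).
by move=> p [ov _] /=; rewrite -rep_change.
Qed.

End Manifold.

(** Smoothness in some charts is smoothness in all of them, around the given
    point: here the chart of the target changes, and below that of the source.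
    The source may be any manifold with injective charts, since it will also be
    a product. *)
Lemma smooth_rep_target M E (A : atlas M E) (N : topologicalType) F (B : atlas N F)
    (phi : M -> N) (i : idx A) (j k : idx B) O m :
  injective_charts A -> finite_dim F -> manifold B ->
  smooth_rep phi i j O -> dom i m -> O (coord i m) -> dom k (phi m) ->
  exists2 O', O' (coord i m) & smooth_rep phi i k O'.
Proof.
move=> iA fF hB [oO img sm] im Om km.
have iB := injective_manifold hB.
pose f := rep i (coord j \o phi).
have fE m' : dom i m' -> f (coord i m') = coord j (phi m').
  by move=> im'; rewrite /f rep_coord.
have jm : dom j (phi m).
  by have [m' [im' e jm']] := img _ Om; rewrite -(iA i m' m).
exists (O `&` f @^-1` overlap j k).
  by split => //=; rewrite fE //; exact: overlap_coord.
have H p : (O `&` f @^-1` overlap j k) p -> exists m',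
    [/\ dom i m', coord i m' = p, dom j (phi m') & dom k (phi m')].
  move=> [/img[m' [im' <- jm']]] /=; rewrite fE // => /overlapP[n [jn kn e]].
  by exists m'; split => //; rewrite -(iB j n (phi m')).
have oO' : open (O `&` f @^-1` overlap j k).
  by apply: open_preimage => //; [exact: (sm 0)|exact: open_overlap].
split => //.
  by move=> p /H[m' [? ? ? ?]]; exists m'.
move=> n.
have Cf : Ck n (O `&` f @^-1` overlap j k) f by apply: Ck_sub (sm n) => p [].
have Oov p : (O `&` f @^-1` overlap j k) p -> overlap j k (f p) by case.
apply: (Ck_ext oO' _ (Ck_comp fF oO' Oov Cf (transition_smooth hB j k n))).
move=> p /H[m' [im' <- jm' km']] /=.
by rewrite fE // transition_coord // rep_coord.
Qed.

Lemma smooth_rep_source (M : topologicalType) E (A : atlas M E) N F (B : atlas N F)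
    (phi : M -> N) (i k : idx A) (j : idx B) O m :
  finite_dim E -> manifold A ->
  smooth_rep phi i j O -> dom i m -> O (coord i m) -> dom k m ->
  exists2 O', O' (coord k m) & smooth_rep phi k j O'.
Proof.
move=> fE hA [oO img sm] im Om km.
have iA := injective_manifold hA.
pose t := rep k (coord i).
exists (overlap k i `&` t @^-1` O).
  by split=> /=; [exact: overlap_coord|rewrite /t rep_coord].
have oO' : open (overlap k i `&` t @^-1` O).
  apply: open_preimage => //; [exact: open_overlap|].
  exact: transition_continuous.
split => //.
  move=> p [/overlapP[m' [km' im' <-]]] /=; rewrite /t rep_coord // => /img.
  move=> [m'' [im'' e jm'']]; exists m'; split => //.
  by rewrite -(iA i m'' m').
move=> n.
have Ct : Ck n (overlap k i `&` t @^-1` O) t.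
  by apply: Ck_sub (transition_smooth hA k i n) => p [].
have Op p : (overlap k i `&` t @^-1` O) p -> O (t p) by case.
apply: (Ck_ext oO' _ (Ck_comp fE oO' Op Ct (sm n))).
by move=> p [ov _] /=; rewrite -rep_change.
Qed.

End Charts.

(** * Tangent maps and brackets on a manifold *)

Section Bracket.
Context {R : realType} {M : Type} {E : normedModType R} (A : atlas M E).
Implicit Types (X Y : fields A).

Lemma bracket_out X Y m i : vector_field X -> vector_field Y -> ~ dom i m ->
  bracket X Y m i = 0.
Proof.
move=> [tX _] [tY _] im; rewrite /bracket (tX m).1 // (tY m).1 //.
by rewrite !derive0 subrr.
Qed.

Lemma bracket_anti X Y : bracket Y X = - bracket X Y.
Proof.
apply/funext => m; apply/funext => i.
by rewrite -[RHS]/(- (bracket X Y m i)) /bracket opprB.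
Qed.

End Bracket.

Section Fields.
Context {R : realType} {M : topologicalType} {E : normedModType R} (A : atlas M E).
Hypotheses (fE : finite_dim E) (hA : manifold A).
Implicit Types (i j k : idx A) (m : M) (X Y Z : fields A).

Let iA : injective_charts A := injective_manifold hA.
Local Notation tangent := (tangent (A := A)).

Definition smooth_near (phi : M -> M) m := forall i j, dom i m ->
  dom j (phi m) -> exists2 O, O (coord i m) & smooth_rep phi i j O.

Lemma smooth_rep_near phi i j O m : smooth_rep phi i j O -> dom i m ->
  O (coord i m) -> smooth_near phi m.
Proof.
move=> srep im Om k l km lm.
have [U' Om' srep'] := smooth_rep_target iA fE hA srep im Om lm.
by have := smooth_rep_source fE hA srep' im Om' km.
Qed.

Lemma smooth_rep_diff phi i j O m : smooth_rep phi i j O -> O (coord i m) ->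
  differentiable (rep i (coord j \o phi)) (coord i m).
Proof. by move=> [_ _ sm]; exact: (sm 1).1. Qed.

Lemma smooth_near_diff phi i j m : smooth_near phi m -> dom i m ->
  dom j (phi m) -> differentiable (rep i (coord j \o phi)) (coord i m).
Proof.
move=> sm im jm; have [U Um srep] := sm i j im jm.
exact: smooth_rep_diff srep Um.
Qed.

(** The value of the tangent map does not depend on the chart at m, since the
    components of v change by the differential of the transition map. *)
Lemma tangent_mapE phi m v i j : smooth_near phi m -> tangent m v ->
  dom i m -> dom j (phi m) ->
  (tangent_map A A phi (m, v)).2 j = 'D_(v i) (rep i (coord j \o phi)) (coord i m).
Proof.
move=> sm tv im jm; apply: xget_unique; first by exists i.
move=> _ [k /= [km _] <-].
by apply: (derive_chart hA tv) => //; exact: smooth_near_diff.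
Qed.

Lemma tangent_map_out phi m v j : ~ dom j (phi m) ->
  (tangent_map A A phi (m, v)).2 j = 0.
Proof. by move=> jm; apply: xgetPN => x [k /= [_ /jm]]. Qed.

Lemma tangent_map_tangent phi m v : smooth_near phi m -> tangent m v ->
  tangent (phi m) (tangent_map A A phi (m, v)).2.
Proof.
move=> sm tv; split=> [j|j k jm km]; first exact: tangent_map_out.
have [i im] := in_chart hA m.
rewrite (tangent_mapE sm tv im jm) (tangent_mapE sm tv im km).
have [U Um srep] := sm i j im jm; have [oO img _] := srep.
have E1 : \forall p \near coord i m,
    (rep j (coord k) \o rep i (coord j \o phi)) p = rep i (coord k \o phi) p.
  have := near_open oO Um; apply: filterS => p /img[m' [im' <- jm']] /=.
  by rewrite !rep_coord.
have e : rep i (coord j \o phi) (coord i m) = coord j (phi m) by rewrite rep_coord.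
rewrite -(near_eq_derive (v i) E1) derive_comp ?e //.
  exact: smooth_near_diff.
exact: transition_diff.
Qed.

(** Functoriality of the tangent map, from the chain rule in one chart at each of
    the three points. *)
Lemma tangent_map_comp phi psi m v : smooth_near phi m ->
  smooth_near psi (phi m) -> smooth_near (psi \o phi) m -> tangent m v ->
  tangent_map A A (psi \o phi) (m, v)
  = tangent_map A A psi (tangent_map A A phi (m, v)).
Proof.
move=> sphi spsi sc tv.
have tw := tangent_map_tangent sphi tv.
rewrite [tangent_map A A phi (m, v)]surjective_pairing.
apply: (f_equal (fun w => (psi (phi m), w))).
apply/funext => k.
have [km|km] := pselect (dom k (psi (phi m))); last first.
  by rewrite -[LHS]/((tangent_map A A (psi \o phi) (m, v)).2 k) tangent_map_out //
    -[RHS]/((tangent_map A A psi (phi m, (tangent_map A A phi (m, v)).2)).2 k)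
    tangent_map_out.
have [i im] := in_chart hA m; have [j jm] := in_chart hA (phi m).
rewrite -[LHS]/((tangent_map A A (psi \o phi) (m, v)).2 k) (tangent_mapE sc tv im) //.
rewrite -[RHS]/((tangent_map A A psi (phi m, (tangent_map A A phi (m, v)).2)).2 k).
rewrite (tangent_mapE spsi tw jm) // (tangent_mapE sphi tv im) //.
have [U Um [oO img _]] := sphi i j im jm.
have E1 : \forall p \near coord i m,
    (rep j (coord k \o psi) \o rep i (coord j \o phi)) p
    = rep i (coord k \o (psi \o phi)) p.
  have := near_open oO Um; apply: filterS => p /img[m' [im' <- jm']] /=.
  by rewrite !rep_coord.
have e : rep i (coord j \o phi) (coord i m) = coord j (phi m) by rewrite rep_coord.
rewrite -(near_eq_derive (v i) E1) derive_comp ?e //.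
  exact: smooth_near_diff.
exact: smooth_near_diff.
Qed.

Lemma tangent_map_id m v : tangent m v -> tangent_map A A id (m, v) = (m, v).
Proof.
move=> tv; apply: (f_equal (fun w => (m, w))); apply/funext => j.
have [jm|jm] := pselect (dom j m); last first.
  by rewrite xgetPN; [rewrite tv.1|move=> x [k /= [_ /jm]]].
have [i im] := in_chart hA m.
apply: xget_unique; first by exists i => //; rewrite (tv.2 i j).
by move=> _ [k /= [km _] <-]; rewrite (tv.2 k j).
Qed.

Lemma field_tangent X m : vector_field X -> tangent m (X m).
Proof. by case. Qed.

Lemma field_Ck X i n : vector_field X -> Ck n (chart_image i) (rep i (X^~ i)).
Proof. by case=> _ sX; exact: sX. Qed.

Lemma field_rep X i m : dom i m -> rep i (X^~ i) (coord i m) = X m i.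
Proof. by move=> im; rewrite rep_coord. Qed.

Lemma field_diff X i m : vector_field X -> dom i m ->
  differentiable (rep i (X^~ i)) (coord i m).
Proof. by move=> vX im; apply: (field_Ck i 1 vX).1; exists m. Qed.

Lemma bracket_rep X Y m i : dom i m ->
  bracket X Y m i = fbracket (rep i (X^~ i)) (rep i (Y^~ i)) (coord i m).
Proof. by move=> im; rewrite /bracket /fbracket !field_rep. Qed.

Lemma near_bracket_rep X Y i m : dom i m -> \forall p \near coord i m,
  rep i ((bracket X Y)^~ i) p = fbracket (rep i (X^~ i)) (rep i (Y^~ i)) p.
Proof.
move=> im; have := near_chart_image hA im; apply: filterS => p [m' im' <-].
by rewrite (field_rep (bracket X Y)) // bracket_rep.
Qed.

(** Components of a field in two charts are related by the transition map, hence
    so are the components of the bracket. *)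
Lemma field_bracket X Y : vector_field X -> vector_field Y ->
  vector_field (bracket X Y).
Proof.
move=> vX vY; split=> [m|i n].
  split=> [i im|i j im jm]; first exact: bracket_out.
  rewrite !bracket_rep //.
  have rel Z : vector_field Z -> \forall q \near coord i m,
      rep j (Z^~ j) (rep i (coord j) q) = 'D_(rep i (Z^~ i) q) (rep i (coord j)) q.
    move=> vZ; have := near_overlap hA im jm.
    apply: filterS => q /overlapP[m' [im' jm' <-]].
    by rewrite (transition_coord hA) // !field_rep // ((field_tangent m' vZ).2 i j).
  have ov := overlap_coord im jm.
  have e := transition_coord hA j im.
  have H := @fbracket_related _ _ _ (rep i (coord j)) (overlap i j) (coord i m)
    (rep i (X^~ i)) (rep i (Y^~ i)) (rep j (X^~ j)) (rep j (Y^~ j))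
    fE fE (open_overlap hA i j) ov (transition_smooth hA i j 2).
  by rewrite e in H; rewrite H //; by [exact: field_diff|exact: rel].
have al S T : vector_field S -> vector_field T ->
    Ck n (chart_image i) (fun p => 'D_(rep i (S^~ i) p) (rep i (T^~ i)) p).
  move=> vS vT.
  exact: (@Ck_along _ _ _ _ n _ _ _ id _ fE (open_chart_image hA i)
    (fun p Ap => Ap) (field_Ck i n vS) (@Ck_idfun R _ n _) (field_Ck i n.+1 vT)).
have oC := open_chart_image hA i.
have := CkD oC (al X Y vX vY) (Ck_scale oC (Ck_cst n _ (-1 : R)) (al Y X vY vX)).
apply: Ck_ext => // p [m im <-].
by rewrite (field_rep (bracket X Y)) // bracket_rep // /fbracket scaleN1r.
Qed.

Lemma field_lincomb (a : R) X Y : vector_field X -> vector_field Y ->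
  vector_field (a *: X + Y).
Proof.
move=> vX vY; split=> [m|i n].
  exact: (tangent_lincomb hA a (field_tangent m vX) (field_tangent m vY)).
have oC := open_chart_image hA i.
have := CkD oC (Ck_scale oC (Ck_cst n _ a) (field_Ck i n vX)) (field_Ck i n vY).
by apply: Ck_ext => // p [m im <-]; rewrite !rep_coord.
Qed.

Lemma field0 : vector_field (0 : fields A).
Proof.
split=> [m|i n]; first exact: tangent0.
apply: (Ck_ext (open_chart_image hA i) _ (Ck_cst n _ (0 : E))) => p [m im <-].
by rewrite rep_coord.
Qed.

Lemma derive_field_lincomb (a : R) X Y i m v : vector_field X ->
  vector_field Y -> dom i m ->
  'D_v (rep i ((a *: X + Y)^~ i)) (coord i m)
  = a *: 'D_v (rep i (X^~ i)) (coord i m) + 'D_v (rep i (Y^~ i)) (coord i m).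
Proof.
move=> vX vY im; have dX := field_diff vX im; have dY := field_diff vY im.
have near_e : \forall p \near coord i m,
    (a *: rep i (X^~ i) + rep i (Y^~ i)) p = rep i ((a *: X + Y)^~ i) p.
  have := near_chart_image hA im; apply: filterS => p [m' im' <-].
  by rewrite -[LHS]/(a *: rep i (X^~ i) (coord i m') + rep i (Y^~ i) (coord i m'))
    !rep_coord.
rewrite -(near_eq_derive _ near_e) deriveD ?deriveZ //;
  by [exact: diff_derivable|apply: derivableZ; exact: diff_derivable].
Qed.

Lemma bracket_lincombr (a : R) X Y Z : vector_field X -> vector_field Y ->
  vector_field Z -> bracket Z (a *: X + Y) = a *: bracket Z X + bracket Z Y.
Proof.
move=> vX vY vZ; apply/funext => m; apply/funext => i.
have -> : (a *: bracket Z X + bracket Z Y) m i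
        = a *: bracket Z X m i + bracket Z Y m i by [].
have vXY := field_lincomb a vX vY.
have [im|im] := pselect (dom i m); last first.
  by rewrite !bracket_out // scaler0 addr0.
rewrite !bracket_rep // /fbracket.
have dZ := field_diff vZ im.
have e1 : rep i ((a *: X + Y)^~ i) (coord i m)
    = a *: rep i (X^~ i) (coord i m) + rep i (Y^~ i) (coord i m).
  by rewrite !rep_coord.
rewrite e1 (derive_lincomb _ _ _ dZ) (derive_field_lincomb a _ vX vY im).
have alg (b : R) (x y z t : E) : b *: x + y - (b *: z + t) = b *: (x - z) + (y - t).
  by rewrite scalerBr opprD addrACA.
exact: alg.
Qed.

Lemma bracket_lincombl (a : R) X Y Z : vector_field X -> vector_field Y ->
  vector_field Z -> bracket (a *: X + Y) Z = a *: bracket X Z + bracket Y Z.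
Proof.
move=> vX vY vZ; rewrite bracket_anti bracket_lincombr //.
by rewrite opprD -scalerN -!bracket_anti.
Qed.

Lemma bracket_jacobi X Y Z : vector_field X -> vector_field Y ->
  vector_field Z -> bracket (bracket X Y) Z
  = bracket X (bracket Y Z) - bracket Y (bracket X Z).
Proof.
move=> vX vY vZ; apply/funext => m; apply/funext => i.
have -> : (bracket X (bracket Y Z) - bracket Y (bracket X Z)) m i
  = bracket X (bracket Y Z) m i - bracket Y (bracket X Z) m i by [].
have vXY := field_bracket vX vY; have vYZ := field_bracket vY vZ.
have vXZ := field_bracket vX vZ.
have [im|im] := pselect (dom i m); last by rewrite !bracket_out // subrr.
have germ S T U : bracket (bracket S T) U m i
   = fbracket (fbracket (rep i (S^~ i)) (rep i (T^~ i))) (rep i (U^~ i)) (coord i m).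
  rewrite bracket_rep // /fbracket -!/(fbracket _ _).
  rewrite (nbhs_singleton (near_bracket_rep S T im)).
  by rewrite (near_eq_derive _ (near_bracket_rep S T im)).
have germ' S T U : bracket U (bracket S T) m i
   = fbracket (rep i (U^~ i)) (fbracket (rep i (S^~ i)) (rep i (T^~ i))) (coord i m).
  rewrite bracket_rep // /fbracket -!/(fbracket _ _).
  rewrite (nbhs_singleton (near_bracket_rep S T im)).
  by rewrite (near_eq_derive _ (near_bracket_rep S T im)).
have Ci : chart_image i (coord i m) by exists m.
rewrite germ !germ'.
exact: (fbracket_jacobi fE (open_chart_image hA i) Ci (field_Ck i 2 vX)
  (field_Ck i 2 vY) (field_Ck i 2 vZ)).
Qed.

End Fields.

(** * Left-invariant fields on a Lie group *)

Section LieGroup.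
Context {R : realType} {G : topologicalGroupCarrierType} {E : normedModType R}.
Context (A : atlas G E).
Hypotheses (fE : finite_dim E) (hA : manifold A).
Hypothesis hmul : smooth_map (product_atlas A A) A setT (fun xy => (xy.1 * xy.2)%g).
Implicit Types (i j k : idx A) (m : G) (X Y Z : fields A).

Let iA : injective_charts A := injective_manifold hA.
Local Notation tangent := (tangent (A := A)).
Local Notation mulg := ( *%g).
Local Notation mulG := (fun xy : G * G => (xy.1 * xy.2)%g).
Local Notation left_inv := (left_invariant (A := A) *%g).

Lemma mul_smooth_rep a x : exists i k j U,
  [/\ dom i a, dom k x, U (coord i a, coord k x) &
   smooth_rep (A := product_atlas A A) mulG (i, k) j U].
Proof.
have [[i k] [j [U [/= [ia kx] oU Ux img sm]]]] := hmul (m := (a, x)) I.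
exists i, k, j, U; split => //; split => //.
by move=> p /img[m' [? ? _ ?]]; exists m'.
Qed.

Lemma left_translation_smooth a x : smooth_near A (mulg a) x.
Proof.
have [i [k [j [U [ia kx Ux srep]]]]] := mul_smooth_rep a x.
exact: (smooth_rep_near fE hA (slice_product iA iA srep ia) kx Ux).
Qed.

Arguments left_translation_smooth : clear implicits.

Lemma left_inv_field X : left_inv X -> vector_field X.
Proof. by case. Qed.

Lemma left_inv_map X a x : left_inv X ->
  tangent_map A A (mulg a) (x, X x) = (a * x, X (a * x))%g.
Proof. by case=> _ lX; apply: lX; rewrite (manifold_cover hA). Qed.

(** A field is left-invariant when it is related to itself by every left
    translation. *)
Lemma left_inv_bracket X Y : left_inv X -> left_inv Y -> left_inv (bracket X Y).
Proof.
move=> lX lY; have vX := left_inv_field lX; have vY := left_inv_field lY.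
have vB := field_bracket fE hA vX vY; split => // a x _ _.
apply: (f_equal (fun w => (a * x, w)%g)); apply/funext => j.
rewrite -[LHS]/((tangent_map A A (mulg a) (x, bracket X Y x)).2 j).
have [jax|jax] := pselect (dom j (a * x)%g); last first.
  by rewrite tangent_map_out // bracket_out.
have sm := left_translation_smooth a x.
have [i ix] := in_chart hA x.
rewrite (tangent_mapE hA sm (field_tangent x vB) ix jax) !bracket_rep //.
have [U Ux srep] := sm i j ix jax; have [oU img smU] := srep.
have rel Z : left_inv Z -> \forall q \near coord i x,
    rep j (Z^~ j) (rep i (coord j \o mulg a) q)
    = 'D_(rep i (Z^~ i) q) (rep i (coord j \o mulg a)) q.
  move=> lZ; have vZ := left_inv_field lZ.
  have := near_open oU Ux; apply: filterS => q /img[x' [ix' <- jx']].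
  rewrite (rep_coord (coord j \o mulg a) iA ix') /= (field_rep hA Z jx') (field_rep hA Z ix').
  rewrite -(tangent_mapE hA (left_translation_smooth a x') (field_tangent x' vZ) ix' jx').
  by rewrite left_inv_map.
have e : rep i (coord j \o mulg a) (coord i x) = coord j (a * x)%g by rewrite rep_coord.
have H := @fbracket_related _ _ _ (rep i (coord j \o mulg a)) U (coord i x)
    (rep i (X^~ i)) (rep i (Y^~ i)) (rep j (X^~ j)) (rep j (Y^~ j))
    fE fE oU Ux (smU 2).
by rewrite e in H; rewrite H //; by [exact: field_diff|exact: rel].
Qed.

Lemma left_inv_lincomb (a : R) X Y : left_inv X -> left_inv Y ->
  left_inv (a *: X + Y).
Proof.
move=> lX lY; have vX := left_inv_field lX; have vY := left_inv_field lY.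
have vB := field_lincomb hA a vX vY; split => // b x _ _.
have sm := left_translation_smooth b x.
apply: (f_equal (fun w => (b * x, w)%g)); apply/funext => j.
rewrite -[LHS]/((tangent_map A A (mulg b) (x, (a *: X + Y) x)).2 j).
have [jbx|jbx] := pselect (dom j (b * x)%g); last first.
  by rewrite tangent_map_out // (field_tangent _ vB).1.
have [i ix] := in_chart hA x.
rewrite (tangent_mapE hA sm (field_tangent x vB) ix jbx).
have -> : (a *: X + Y) x i = a *: X x i + Y x i by [].
rewrite derive_lincomb; last exact: (smooth_near_diff sm).
rewrite -(tangent_mapE hA sm (field_tangent x vX) ix jbx).
rewrite -(tangent_mapE hA sm (field_tangent x vY) ix jbx).
by rewrite !left_inv_map.
Qed.

Lemma left_inv0 : left_inv 0.
Proof.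
split=> [|b x _ _]; first exact: field0.
have sm := left_translation_smooth b x.
apply: (f_equal (fun w => (b * x, w)%g)); apply/funext => j.
rewrite -[LHS]/((tangent_map A A (mulg b) (x, (0 : fields A) x)).2 j).
have [jbx|jbx] := pselect (dom j (b * x)%g); last by rewrite tangent_map_out.
have [i ix] := in_chart hA x.
rewrite (tangent_mapE hA sm (tangent0 A x) ix jbx).
exact: (derive0 (rep i (coord j \o mulg b)) (coord i x)).
Qed.

(** The candidate for the left-invariant field with value q at the identity. *)
Definition inv_field (q : idx A -> E) : fields A :=
  fun m => (tangent_map A A (mulg m) (1%g, q)).2.

Lemma inv_field_tangent q m : tangent 1%g q -> tangent m (inv_field q m).
Proof.
move=> tq; have := tangent_map_tangent hA (left_translation_smooth m 1%g) tq.
by rewrite mulg1.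
Qed.

(** Let F be the multiplication in charts near [(a, 1)], and p_1 the coordinates
    of 1. The field has components [D_(0, q) F (p, p_1)] at p, a partial
    derivative of a smooth function of two variables. This is in the chart of a
    given by the smoothness of the multiplication, whence a change of chart. *)
Lemma inv_field_smooth q i n : tangent 1%g q ->
  Ck n (chart_image i) (rep i ((inv_field q)^~ i)).
Proof.
move=> tq; apply: Ck_local => p [a ia <-].
have [i1 [k [j [U [i1a k1 Ux srep]]]]] := mul_smooth_rep a 1%g.
have ia1 : dom i (a * 1)%g by rewrite mulg1.
have [U' U'x srep'] := smooth_rep_target
  (injective_product iA iA) fE hA srep (conj i1a k1 : @dom _ _ _ (product_atlas A A) (i1, k) (a, 1%g)) Ux ia1.
have [oU' img sm] := srep'; set F := rep _ _ in sm.
have srepS (a' : G) (i1a' : dom i1 a') := slice_product iA iA srep' i1a'.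
pose jj (p : E) : E * E := (p, coord k 1%g); pose ll (p : E) : E * E := (p, 0).
have jl (h : R) u r : jj (h *: u + r) = h *: ll u + jj r.
  by rewrite -[RHS]/(h *: u + r, h *: 0 + coord k 1%g) scaler0 add0r.
have dj r : differentiable jj r by apply: differentiable_pair; exact: ex_diff.
have oS : open (jj @^-1` U').
  rewrite -[X in open X]setTI; apply: open_preimage => //; first exact: openT.
  by move=> r _; exact: differentiable_continuous.
have CS : Ck n (jj @^-1` U') (rep i1 ((inv_field q)^~ i)).
  apply: (Ck_ext oS _ (Ck_affine jl dj ((sm n.+1).2 (0, q k)))) => r U'r.
  have [[a' x'] /= [[i1a' kx'] [ea' ex'] ia']] := img _ U'r.
  have x1 : x' = 1%g by exact: iA ex'.
  rewrite {}x1 in kx' ex' ia'.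
  rewrite -ea' rep_coord // /inv_field.
  rewrite (tangent_mapE hA (left_translation_smooth a' 1%g) tq kx' ia').
  have U'a : U' (coord i1 a', coord k 1%g) by rewrite ea'.
  have [oS' img' _] := srepS a' i1a'.
  pose j2 (p : E) : E * E := (coord i1 a', p).
  have E1 : \forall r \near coord k 1%g, rep k (coord i \o mulg a') r = (F \o j2) r.
    have := near_open oS' U'a.
    apply: filterS => s /img'[x2 [kx2 <- ix2]]; rewrite rep_coord //=.
    rewrite -[j2 (coord k x2)]/(@coord _ _ _ (product_atlas A A) (i1, k) (a', x2)).
    by rewrite /F rep_coord //; exact: injective_product.
  rewrite (near_eq_derive _ E1).
  have j2l (h : R) u s : j2 (h *: u + s) = h *: ((0, u) : E * E) + j2 s.
    by rewrite -[RHS]/(h *: 0 + coord i1 a', h *: u + s) scaler0 add0r.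
  by rewrite (derive_affine F _ _ j2l).
have [W [_ Wa CW]] := Ck_rep_change fE hA ia i1a oS U'x CS.
by exists W.
Qed.

Lemma inv_field_left_inv q : tangent 1%g q -> left_inv (inv_field q).
Proof.
move=> tq; split.
  split=> [m|i n]; [exact: inv_field_tangent|exact: inv_field_smooth].
move=> a x _ _.
have E1 : tangent_map A A (mulg x) (1%g, q) = (x, inv_field q x).
  by rewrite /inv_field -{2}(mulg1 x).
have E2 : mulg (a * x)%g = mulg a \o mulg x :> (G -> G).
  by apply/funext => y /=; rewrite mulgA.
rewrite -E1 -(tangent_map_comp hA) //; last 3 first.
- exact: left_translation_smooth.
- exact: left_translation_smooth.
- by rewrite -E2; exact: left_translation_smooth.
by rewrite -E2 /inv_field -{2}(mulg1 (a * x)%g).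
Qed.

(** Transport q to the identity by the left translation by m^-1, and extend. *)
Lemma left_inv_exists m q : tangent m q -> exists2 X, left_inv X & X m = q.
Proof.
move=> tq.
have t1 := tangent_map_tangent hA (left_translation_smooth m^-1%g m) tq.
pose q1 := (tangent_map A A (mulg m^-1%g) (m, q)).2.
have tq1 : tangent 1%g q1 by rewrite -(mulVg m).
exists (inv_field q1); first exact: inv_field_left_inv.
have E0 : (1%g, q1) = tangent_map A A (mulg m^-1%g) (m, q) by rewrite -(mulVg m).
have E2 : mulg m \o mulg m^-1%g = id :> (G -> G).
  by apply/funext => y /=; rewrite mulVKg.
rewrite /inv_field E0 -(tangent_map_comp hA) //; last 3 first.
- exact: left_translation_smooth.
- exact: left_translation_smooth.
- move=> i j im jm; rewrite E2 in jm *.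
  have := left_translation_smooth 1%g m.
  have -> : mulg 1%g = id :> (G -> G) by apply/funext => y; rewrite mul1g.
  exact.
by rewrite E2 tangent_map_id.
Qed.

End LieGroup.

(** * Complete and vertical lifts in charts *)

Section Lifts.
Context {R : realType} {M : topologicalType} {E : normedModType R} (A : atlas M E).
Hypotheses (fE : finite_dim E) (hA : manifold A).
Implicit Types (i j k : idx A) (m : M) (X Y : fields A) (y : bundle A).

Let iA : injective_charts A := injective_manifold hA.
Local Notation TA := (tangent_atlas A).
Local Notation trep i X := (rep (A := A) i (X^~ i)).

Lemma injective_tangent : injective_charts TA.
Proof.
move=> i [m u] [m' v] /= [im tu] [im' tv] [em ev].
have e : m = m' by exact: iA em.
by rewrite -{}e in tv *; rewrite (tangent_eq tu tv im ev).
Qed.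

Lemma tangent_bundle_point i m q : dom i m ->
  exists2 v, @dom _ _ _ TA i (m, v) & v i = q.
Proof. by move=> im; have [v tv <-] := tangent_exists hA q im; exists v. Qed.

Lemma in_tangent_chart i p q : chart_image (A := A) i p ->
  exists y, [/\ @dom _ _ _ TA i y, coord i y.1 = p & y.2 i = q].
Proof.
by move=> [m im <-]; have [v ? ?] := tangent_bundle_point q im; exists (m, v).
Qed.

Lemma near_fst (V W : normedModType R) (P : set V) (p : V) (q : W) :
  (\forall p' \near p, P p') -> \forall r \near (p, q), P r.1.
Proof. by move=> nP; apply: (@cvg_fst _ _ (nbhs p) (nbhs q)). Qed.

Lemma near_rep_tangent (h : bundle A -> E * E) i y (H : E * E -> E * E) :
  @dom _ _ _ TA i y ->
  (forall z, @dom _ _ _ TA i z -> h z = H (coord i z.1, z.2 i)) ->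
  \forall r \near @coord _ _ _ TA i y, rep (A := TA) i h r = H r.
Proof.
move=> [im _] hH.
have := near_fst (y.2 i) (near_chart_image hA im); apply: filterS => -[p q] /= Cp.
have [z [iz <- <-]] := in_tangent_chart q Cp.
by rewrite -hH // -[(coord i z.1, z.2 i)]/(@coord _ _ _ TA i z) rep_coord //;
   exact: injective_tangent.
Qed.

Lemma derive_rep_tangent (h : bundle A -> E * E) i y (H : E * E -> E * E) d :
  @dom _ _ _ TA i y ->
  (forall z, @dom _ _ _ TA i z -> h z = H (coord i z.1, z.2 i)) ->
  'D_d (rep (A := TA) i h) (@coord _ _ _ TA i y) = 'D_d H (@coord _ _ _ TA i y).
Proof. by move=> iy hH; exact: near_eq_derive (near_rep_tangent iy hH). Qed.

Lemma vertical_liftE X Z y i : vertical_lift X Z -> @dom _ _ _ TA i y ->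
  Z y i = (0, X y.1 i).
Proof.
move=> [_ vZ] iy; have := vZ y i iy => -[_ <-].
pose l (t : R) : E := t *: X y.1 i.
have lin : linear l.
  by move=> a u v; rewrite /l scalerDl scalerA.
pose lM := GRing.isLinear.Build _ _ _ _ _ lin.
pose lL : {linear R -> E} := HB.pack l lM.
have cl : continuous lL by exact: scalel_continuous.
have [d1 e1] := derive_linear (0 : R) (1 : R) cl.
have d2 : differentiable (fun t : R => y.2 i + l t) 0.
  by apply: (differentiableD (differentiable_cst _ _) d1).
have d0 : differentiable (fun t : R => coord i y.1 : E) 0 by exact: differentiable_cst.
rewrite -[LHS]/('D_1 (fun t : R => (coord i y.1, y.2 i + l t)) 0).
rewrite (derive_pair _ d0 d2) derive_cst; congr pair.
rewrite -[LHS]/('D_1 (cst (y.2 i) + l) 0) deriveD; last 2 first.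
- by apply: diff_derivable; exact: differentiable_cst.
- by apply: diff_derivable; exact: d1.
by rewrite derive_cst add0r -[LHS]/('D_1 lL 0) e1 /= /l scale1r.
Qed.

(** Let [F (t, p)] be the flow of X in charts. The lift is the derivative at
    [t = 0] of [(F, D_(0, v) F)], whose second component is
    [D_(1, 0) D_(0, v) F = D_(0, v) D_(1, 0) F], and [D_(1, 0) F] is X at
    [t = 0]. *)
Lemma complete_liftE X Z y i : vector_field X -> complete_lift X Z ->
  @dom _ _ _ TA i y -> Z y i = (X y.1 i, 'D_(y.2 i) (trep i X) (coord i y.1)).
Proof.
move=> vX [_ cZ] iy; have [im tv] := iy; set m := y.1 in im tv *; set v := y.2 in tv *.
have [eps [U [phi [Um fl H]]]] := cZ m.
have [_ <-] := H y i erefl iy.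
have [eps0 oU sphi phi0 dphi] := fl.
pose psi (tm : R * M) := phi tm.1 tm.2.
have D0m : [set tm : R * M | `|tm.1| < eps /\ U tm.2] (0, m).
  by split => //=; rewrite normr0.
have [[[] i0] [j [W [/= [_ i0m] oW Wm img sm]]]] := sphi (0, m) D0m.
have iL : injective_charts (product_atlas (line_atlas R) A).
  by apply: injective_product => //; exact: injective_line.
have srep : smooth_rep (A := product_atlas (line_atlas R) A) (B := A) psi (tt, i0) j W.
  by split => // p /img[m' [? ? _ ?]]; exists m'.
have iphi0 : dom i (psi (0, m)) by rewrite /psi /= phi0.
have [W' W'm srep'] := smooth_rep_target iL fE hA srep
  (conj I i0m : @dom _ _ _ (product_atlas (line_atlas R) A) (tt, i0) (0, m)) Wm iphi0.
have [oW' img' sm'] := srep'; set F := rep _ _ in sm'.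
pose p0 := coord i0 m; pose v0 := v i0.
have slice t := slice_product (a := t) (@injective_line R) iA srep' I.
have FE t p : W' (t, p) -> exists m', [/\ dom i0 m', coord i0 m' = p,
    dom i (phi t m') & F (t, p) = coord i (phi t m')].
  move=> Wtp; have [[t' m'] /= [[_ i0m'] [et em] im']] := img' _ Wtp.
  exists m'; rewrite -et; split => //.
  by rewrite -em /F -[(t', coord i0 m')]/(@coord _ _ _ (product_atlas (line_atlas R) A)
    (tt, i0) (t', m')) rep_coord.
have line_near p : W' (0, p) -> \forall t \near (0 : R), W' (t, p).
  move=> W0p; pose jp (t : R) : R * E := (t, p).
  have cj t : {for t, continuous jp}.
    apply: differentiable_continuous; apply: differentiable_pair; exact: ex_diff.
  exact: (cj 0 _ (open_nbhs_nbhs (conj oW' W0p))).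
(* At t = 0 the flow equation holds at every point of U, not only at m. *)
have time p m' : W' (0, p) -> dom i0 m' -> coord i0 m' = p -> U m' ->
    'D_(1, 0) F (0, p) = X m' i.
  move=> W0p i0m' em Um'.
  have jl (h : R) (s r : R) : ((h *: s + r, p) : R * E) = h *: (s, 0) + (r, p).
    by rewrite -[RHS]/(h *: s + r, h *: 0 + p) scaler0 add0r.
  rewrite -(derive_affine (j := fun t : R => (t, p) : R * E) (l := fun s => (s, 0))
    F 0 1 jl).
  have near_e : \forall t \near (0 : R), (F \o (fun t => (t, p))) t = coord i (phi t m').
    have := line_near p W0p; apply: filterS => t Wtp /=.
    have [m'' [i0m'' e'' _ ->]] := FE _ _ Wtp.
    by rewrite (iA i0m'' i0m') // em.
  rewrite (near_eq_derive _ near_e).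
  have [m'' [i0m'' e'' im'' _]] := FE _ _ W0p.
  have mm : m'' = m' by apply: (iA i0m'' i0m'); rewrite em.
  rewrite mm in im''.
  have z0 : `|0 : R| < eps by rewrite normr0.
  by have [_ ->] := dphi 0 m' i z0 Um' im''; rewrite phi0.
(* The tangent maps are read in the chart i0 at m and the chart i at phi t m. *)
have near_e : \forall t \near (0 : R),
    @coord _ _ _ TA i (tangent_map A A (phi t) y) = (F (t, p0), 'D_(0, v0) F (t, p0)).
  have := line_near p0 W'm; apply: filterS => t Wtp.
  have [m'' [i0m'' e'' im'' Fe]] := FE _ _ Wtp.
  have mm : m'' = m by exact: iA e''.
  rewrite mm in im'' Fe.
  have snear := smooth_rep_near fE hA (slice t) i0m Wtp.
  rewrite [y]surjective_pairing -/m -/v.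
  rewrite -[LHS]/(coord i (phi t m), (tangent_map A A (phi t) (m, v)).2 i) Fe.
  apply: (f_equal (fun w => (_, w))).
  rewrite (tangent_mapE hA snear tv i0m im'').
  have jl (h : R) (s r : E) : ((t, h *: s + r) : R * E) = h *: (0, s) + (t, r).
    by rewrite -[RHS]/(h *: 0 + t, h *: s + r) scaler0 add0r.
  have near_s : \forall r \near p0, rep i0 (coord i \o phi t) r
      = (F \o (fun r : E => (t, r) : R * E)) r.
    have [oS _ _] := slice t.
    have := near_open oS (Wtp : [set p | W' (t, p)] p0).
    apply: filterS => r Wtr /=; have [m3 [i0m3 <- im3 Fr]] := FE _ _ Wtr.
    by rewrite rep_coord.
  rewrite (near_eq_derive _ near_s).
  exact: (derive_affine F _ _ jl).
rewrite (near_eq_derive _ near_e).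
have CF : Ck 2 W' F := sm' 2; have dF := CF.1 _ W'm.
have jl0 (h : R) (s r : R) : ((h *: s + r, p0) : R * E) = h *: (s, 0) + (r, p0).
  by rewrite -[RHS]/(h *: s + r, h *: 0 + p0) scaler0 add0r.
have dj : differentiable (fun t : R => (t, p0) : R * E) 0.
  by apply: differentiable_pair; exact: ex_diff.
have dFv := (CF.2 (0, v0)).1 _ W'm.
rewrite (derive_pair _ (differentiable_comp dj dF) (differentiable_comp dj dFv)).
rewrite (derive_affine F (0 : R) (1 : R) jl0).
rewrite (derive_affine ('D_(0, v0) F) (0 : R) (1 : R) jl0).
rewrite (time p0 m W'm i0m erefl Um) (schwarz _ _ fE oW' W'm CF).
apply: (f_equal (fun w => (X m i, w))).
have jl1 (h : R) (s r : E) : ((0, h *: s + r) : R * E) = h *: (0, s) + (0, r).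
  by rewrite -[RHS]/(h *: 0 + 0, h *: s + r) scaler0 add0r.
rewrite -(derive_affine (j := fun r : E => (0, r) : R * E) (l := fun s => (0, s))
    ('D_(1, 0) F) p0 v0 jl1).
have near_s : \forall r \near p0,
    ('D_(1, 0) F \o (fun r : E => (0, r) : R * E)) r = rep i0 (X^~ i) r.
  have [oS _ _] := slice 0.
  have oI : open (coord i0 @` (dom i0 `&` U)).
    apply: (manifold_chart_open hA); last by move=> x [].
    by apply: openI => //; exact: manifold_dom_open.
  have := near_open oI (ex_intro2 _ _ m (conj i0m Um) erefl).
  have := near_open oS (W'm : [set p | W' (0, p)] p0).
  apply: filterS2 => r W0r [m' [i0m' Um'] em] /=.
  by rewrite (time r m' W0r i0m' em Um') -em rep_coord.
rewrite (near_eq_derive _ near_s).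
have dXi : differentiable (trep i X) (coord i m) := field_diff vX im.
exact: (derive_chart hA tv i0m im dXi).
Qed.

End Lifts.

(** * Brackets of lifts *)

Section LiftAlgebra.
Context {R : realType} {M : topologicalType} {E : normedModType R} (A : atlas M E).
Hypotheses (fE : finite_dim E) (hA : manifold A).
Context (c w : fields A -> fields (tangent_atlas A)).
Hypotheses (hc : forall X, vector_field X -> complete_lift X (c X))
  (hw : forall X, vector_field X -> vertical_lift X (w X)).
Implicit Types (i j k : idx A) (m : M) (X Y : fields A) (y : bundle A).

Let iA : injective_charts A := injective_manifold hA.
Local Notation TA := (tangent_atlas A).
Local Notation trep i X := (rep (A := A) i (X^~ i)).

Lemma field_complete X : vector_field X -> vector_field (A := TA) (c X).
Proof. by move=> /hc[]. Qed.

Lemma field_vertical X : vector_field X -> vector_field (A := TA) (w X).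
Proof. by move=> /hw[]. Qed.

Lemma completeE X y i : vector_field X -> @dom _ _ _ TA i y ->
  c X y i = (X y.1 i, 'D_(y.2 i) (trep i X) (coord i y.1)).
Proof. by move=> vX iy; exact: (complete_liftE fE hA vX (hc vX) iy). Qed.

Lemma verticalE X y i : vector_field X -> @dom _ _ _ TA i y ->
  w X y i = (0, X y.1 i).
Proof. by move=> vX iy; exact: (vertical_liftE (hw vX) iy). Qed.

Lemma complete_local X i z : vector_field X -> @dom _ _ _ TA i z ->
  c X z i = (fun pq : E * E => (trep i X pq.1, 'D_(pq.2) (trep i X) pq.1))
    (coord i z.1, z.2 i).
Proof. by move=> vX iz; rewrite completeE //= (field_rep hA) //; case: iz. Qed.

Lemma vertical_local X i z : vector_field X -> @dom _ _ _ TA i z ->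
  w X z i = (fun pq : E * E => (0 : E, trep i X pq.1)) (coord i z.1, z.2 i).
Proof. by move=> vX iz; rewrite verticalE //= (field_rep hA) //; case: iz. Qed.

Lemma derive_complete X i y a b : vector_field X -> @dom _ _ _ TA i y ->
  'D_(a, b) (rep (A := TA) i ((c X)^~ i)) (@coord _ _ _ TA i y)
  = ('D_a (trep i X) (coord i y.1),
     'D_a ('D_(y.2 i) (trep i X)) (coord i y.1) + 'D_b (trep i X) (coord i y.1)).
Proof.
move=> vX iy.
have H z := @complete_local X i z vX.
apply: (eq_trans (derive_rep_tangent hA (a, b) iy H)).
have Cm : chart_image (A := A) i (coord i y.1) by exists y.1 => //; case: iy.
exact: (derive_tangent_lift _ _ _ fE fE (open_chart_image hA i) Cm (field_Ck i 2 vX)).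
Qed.

Lemma derive_vertical X i y a b : vector_field X -> @dom _ _ _ TA i y ->
  'D_(a, b) (rep (A := TA) i ((w X)^~ i)) (@coord _ _ _ TA i y)
  = (0, 'D_a (trep i X) (coord i y.1)).
Proof.
move=> vX iy; have [im _] := iy.
have H z := @vertical_local X i z vX.
apply: (eq_trans (derive_rep_tangent hA (a, b) iy H)).
exact: (derive_vertical_lift _ _ _ (field_diff vX im)).
Qed.

Lemma lifted_fields_eq (Z T : fields TA) :
  (forall y i, Z y i = T y i) -> Z = T.
Proof. by move=> ZT; apply/funext => y; apply/funext => i; exact: ZT. Qed.

(** The terms with second derivatives, symmetric, match those of the derivative
    of [[X, Y]] along the fibre coordinate. *)
Lemma bracket_complete_complete X Y : vector_field X -> vector_field Y ->
  bracket (c X) (c Y) = c (bracket X Y).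
Proof.
move=> vX vY; have vB := field_bracket fE hA vX vY.
have vcX := field_complete vX; have vcY := field_complete vY.
apply: lifted_fields_eq => y i.
have [iy|iy] := pselect (@dom _ _ _ TA i y); last first.
  by rewrite bracket_out // ((field_complete vB).1 y).1.
have [im _] := iy.
rewrite /bracket -/(bracket X Y) (completeE vX iy) (completeE vY iy) (completeE vB iy).
rewrite (derive_complete _ _ vX iy) (derive_complete _ _ vY iy).
have Cm : chart_image (A := A) i (coord i y.1) by exists y.1.
have oC := open_chart_image hA (i : idx A).
have CX := field_Ck i 2 vX; have CY := field_Ck i 2 vY.
rewrite (near_eq_derive _ (near_bracket_rep hA X Y im)).
rewrite (derive_fbracket _ fE oC Cm CX CY) !(field_rep hA) //.
rewrite (schwarz (y.2 i) (X y.1 i) fE oC Cm CY) (schwarz (y.2 i) (Y y.1 i) fE oC Cm CX).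
have alg (a b x z t s : E) : (a, x + z) - (b, t + s) = (a - b, z + x - (s + t)).
  by rewrite (addrC z) (addrC s).
exact: alg.
Qed.

Lemma bracket_complete_vertical X Y : vector_field X -> vector_field Y ->
  bracket (c X) (w Y) = w (bracket X Y).
Proof.
move=> vX vY; have vB := field_bracket fE hA vX vY.
have vcX := field_complete vX; have vwY := field_vertical vY.
apply: lifted_fields_eq => y i.
have [iy|iy] := pselect (@dom _ _ _ TA i y); last first.
  by rewrite bracket_out // ((field_vertical vB).1 y).1.
rewrite /bracket -/(bracket X Y) (completeE vX iy) (verticalE vY iy) (verticalE vB iy).
rewrite (derive_complete _ _ vX iy) (derive_vertical _ _ vY iy) !derive0.
have alg (x z : E) : (0, x) - (0, 0 + z) = (0, x - z) :> E * E.
  by rewrite -[LHS]/(0 - 0, x - (0 + z)) subrr add0r.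
exact: alg.
Qed.

Lemma bracket_vertical_vertical X Y : vector_field X -> vector_field Y ->
  bracket (w X) (w Y) = 0.
Proof.
move=> vX vY.
have vwX := field_vertical vX; have vwY := field_vertical vY.
apply: lifted_fields_eq => y i.
have [iy|iy] := pselect (@dom _ _ _ TA i y); last by rewrite bracket_out.
rewrite /bracket (verticalE vX iy) (verticalE vY iy).
by rewrite (derive_vertical _ _ vX iy) (derive_vertical _ _ vY iy) !derive0 subrr.
Qed.

(** The transition maps of the tangent bundle are the tangent maps of those of
    M; their derivatives are linear, which makes tangent vectors of the tangent
    bundle a vector space. *)
Lemma derive_tangent_transition y i j a b :
  @dom _ _ _ TA i y -> @dom _ _ _ TA j y ->
  'D_(a, b) (rep (A := TA) i (@coord _ _ _ TA j)) (@coord _ _ _ TA i y)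
  = ('D_a (rep i (coord j)) (coord i y.1),
     'D_a ('D_(y.2 i) (rep i (coord j))) (coord i y.1)
     + 'D_b (rep i (coord j)) (coord i y.1)).
Proof.
move=> iy jy; have [im tv] := iy; have [jm _] := jy.
have near_e : \forall r \near @coord _ _ _ TA i y,
    rep (A := TA) i (@coord _ _ _ TA j) r
    = (fun pq : E * E => (rep i (coord j) pq.1, 'D_(pq.2) (rep i (coord j)) pq.1)) r.
  have := near_fst (y.2 i) (near_overlap hA im jm).
  apply: filterS => -[p q] /= /overlapP[m [im' jm' <-]].
  have [v iv <-] := tangent_bundle_point hA q im'.
  rewrite -[(coord i m, v i)]/(@coord _ _ _ TA i (m, v)) rep_coord //; last first.
    exact: injective_tangent.
  rewrite /= (transition_coord hA) //; apply: (f_equal (fun t => (_, t))).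
  by have [_ [_ tj]] := iv; exact: tj.
rewrite (near_eq_derive _ near_e).
exact: (derive_tangent_lift _ _ _ fE fE (open_overlap hA i j) (overlap_coord im jm)
  (transition_smooth hA i j 2)).
Qed.

Lemma tangent_bundle_lincomb y (a : R) d d' :
  tangent (A := TA) y d -> tangent (A := TA) y d' -> tangent (A := TA) y (a *: d + d').
Proof.
move=> [d0 td] [d'0 td']; split=> [i iy|i j iy jy].
  have -> : (a *: d + d') i = a *: d i + d' i by [].
  by rewrite d0 // d'0 // scaler0 addr0.
have E' k : (a *: d + d') k = a *: d k + d' k by [].
rewrite !E' (td i j) // (td' i j) //.
rewrite [d i]surjective_pairing [d' i]surjective_pairing.
have e (r s t u : E) : a *: (r, s) + (t, u) = (a *: r + t, a *: s + u) by [].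
rewrite e !derive_tangent_transition // e.
have ov : overlap (A := A) i j (@coord _ _ _ A i y.1) by apply: overlap_coord; [case: iy|case: jy].
have df := (transition_smooth hA i j 2).1 _ ov.
have df2 := ((transition_smooth hA i j 2).2 (y.2 i)).1 _ ov.
rewrite (derive_lincomb a (d i).1 (d' i).1 df) (derive_lincomb a (d i).2 (d' i).2 df).
rewrite (derive_lincomb a (d i).1 (d' i).1 df2).
by rewrite scalerDr addrACA.
Qed.

Lemma tangent_bundle_eq y d d' i : tangent (A := TA) y d -> tangent (A := TA) y d' ->
  @dom _ _ _ TA i y -> d i = d' i -> d = d'.
Proof.
move=> [d0 td] [d'0 td'] iy e; apply/funext => j.
have [jy|jy] := pselect (@dom _ _ _ TA j y); last by rewrite d0 // d'0.
by rewrite (td i j) // (td' i j) // e.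
Qed.

(** In a chart [c X + w Y] is [(X, D_q X + Y)]: choose the value of X, then that
    of Y, at the base point. *)
Lemma lift_span (V : set (fields A)) y i d :
  (forall X, V X -> vector_field X) ->
  (forall m q, tangent (A := A) m q -> exists2 X, V X & X m = q) ->
  @dom _ _ _ TA i y -> tangent (A := TA) y d ->
  exists X Y, [/\ V X, V Y & d = c X y + w Y y].
Proof.
move=> VF span iy td; have [im tv] := iy.
have [q1 t1 e1] := tangent_exists hA (d i).1 im.
have [X VX XE] := span _ _ t1.
have [q2 t2 e2] := tangent_exists hA
  ((d i).2 - 'D_(y.2 i) (trep i X) (@coord _ _ _ A i y.1)) im.
have [Y VY YE] := span _ _ t2.
exists X, Y; split => //.
have vX := VF _ VX; have vY := VF _ VY.
have ts : tangent (A := TA) y (c X y + w Y y).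
  rewrite -[c X y]scale1r; apply: tangent_bundle_lincomb.
    exact: (field_complete vX).1.
  exact: (field_vertical vY).1.
apply: (tangent_bundle_eq td ts iy).
have -> : (c X y + w Y y) i = c X y i + w Y y i by [].
rewrite (completeE vX iy) (verticalE vY iy) XE YE e1 e2 [LHS]surjective_pairing.
have alg (a b x : E) : (a, b) = (a, x) + (0, b - x).
  by rewrite -[RHS]/(a + 0, x + (b - x)) addr0 addrC subrK.
exact: alg.
Qed.

Lemma complete_lincomb (a : R) X Y : vector_field X -> vector_field Y ->
  c (a *: X + Y) = a *: c X + c Y.
Proof.
move=> vX vY; have vB := field_lincomb hA a vX vY.
apply: lifted_fields_eq => y i.
have -> : (a *: c X + c Y) y i = a *: c X y i + c Y y i by [].
have [iy|iy] := pselect (@dom _ _ _ TA i y); last first.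
  by rewrite !((field_complete _).1 y).1 // scaler0 addr0.
have [im _] := iy.
rewrite (completeE vX iy) (completeE vY iy) (completeE vB iy).
by rewrite (derive_field_lincomb hA a (y.2 i) vX vY im).
Qed.

Lemma vertical_lincomb (a : R) X Y : vector_field X -> vector_field Y ->
  w (a *: X + Y) = a *: w X + w Y.
Proof.
move=> vX vY; have vB := field_lincomb hA a vX vY.
apply: lifted_fields_eq => y i.
have -> : (a *: w X + w Y) y i = a *: w X y i + w Y y i by [].
have [iy|iy] := pselect (@dom _ _ _ TA i y); last first.
  by rewrite !((field_vertical _).1 y).1 // scaler0 addr0.
rewrite (verticalE vX iy) (verticalE vY iy) (verticalE vB iy).
by rewrite -[RHS]/(a *: 0 + 0, a *: X y.1 i + Y y.1 i) scaler0 addr0.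
Qed.

Lemma vertical0 : w 0 = 0.
Proof.
have := vertical_lincomb 1 (field0 hA) (field0 hA).
rewrite !scale1r add0r => E'.
by apply: (@addrI _ (w 0)); rewrite addr0; exact: esym E'.
Qed.

Lemma bracket_vertical_complete X Y : vector_field X -> vector_field Y ->
  bracket (w X) (c Y) = w (bracket X Y).
Proof.
move=> vX vY; rewrite bracket_anti bracket_complete_vertical //.
have vB := field_bracket fE hA vY vX.
rewrite (bracket_anti Y X); have := vertical_lincomb (-1) vB (field0 hA).
by rewrite vertical0 !addr0 !scaleN1r => ->.
Qed.

End LiftAlgebra.

(** * The Koszul formula for left-invariant lifts *)

Section KoszulFormula.
Context {R : realType} {M : Type} {E : normedModType R} (A : atlas M E).
Context (g : forms A) (D : fields A -> fields A -> fields A).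
Hypotheses (hg : riemannian g) (hD : levi_civita g D).
Hypothesis hopen : forall i : idx A, open (chart_image i).
Hypothesis hinj : injective_charts A.
Implicit Types (X Y Z : fields A).

Lemma lie_derivative_cst X (h : M -> R) (k : R) m :
  (forall i z, @dom _ _ _ A i z -> h z = k) -> lie_derivative X h m = 0.
Proof.
move=> hk; rewrite /lie_derivative; case: xgetP => // _ _ [i im <-].
rewrite -(derive_cst k (coord i m) (X m i)); apply: near_eq_derive.
have Cm : chart_image i (coord i m) by exists m.
have := near_open (hopen i) Cm; apply: filterS => p [z iz <-].
by rewrite rep_coord // (hk i).
Qed.

Definition constant_product X Y : Prop :=
  exists k : R, forall i z, @dom _ _ _ A i z -> g z (X z) (Y z) = k.

Lemma form_sub m u v z : tangent (A := A) m u -> tangent (A := A) m v ->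
  tangent (A := A) m z -> g m (u - v) z = g m u z - g m v z.
Proof.
move=> tu tv tz; have := riemannian_linear hg (- 1) tv tu tz.
by rewrite scaleN1r addrC mulN1r addrC => ->; rewrite addrC.
Qed.

Lemma form0 m z : tangent (A := A) m z -> g m 0 z = 0.
Proof. by move=> tz; rewrite -(subrr z) form_sub // subrr. Qed.

(** Compatibility with the metric, for constant products, says that
    [<D_X Y, Z>] is antisymmetric in Y and Z; with the absence of torsion this
    determines it as a combination of brackets. *)
Lemma koszul_constant X Y Z m :
  vector_field X -> vector_field Y -> vector_field Z ->
  constant_product Y Z -> constant_product Z X -> constant_product X Y ->
  2 * g m (D X Y m) (Z m)
  = g m (bracket X Y m) (Z m) - g m (bracket Y Z m) (X m)
    + g m (bracket Z X m) (Y m).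
Proof.
move=> vX vY vZ.
have met S T U : vector_field S -> vector_field T -> vector_field U ->
    constant_product T U -> g m (D S U m) (T m) = - g m (D S T m) (U m).
  move=> vS vT vU [k hk]; have [tSU _] := connection_field hD vS vU.
  have [tT _] := vT.
  have := f_equal (fun h => h m) (connection_metric hD vS vT vU).
  rewrite /= (lie_derivative_cst _ _ hk) => /esym/eqP.
  by rewrite addr_eq0 => /eqP ->; rewrite opprK (riemannian_sym hg).
have tor S T U : vector_field S -> vector_field T -> vector_field U ->
    g m (bracket S T m) (U m) = g m (D S T m) (U m) - g m (D T S m) (U m).
  move=> vS vT vU; rewrite -(connection_torsion_free hD vS vT).
  have [tST _] := connection_field hD vS vT.
  have [tTS _] := connection_field hD vT vS.
  have [tU _] := vU.
  exact: (form_sub (tST m) (tTS m) (tU m)).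
move=> cYZ cZX cXY; rewrite !tor //.
rewrite (met Y Z X) // (met Z X Y) // (met X Y Z) //.
move: (g m _ _) (g m _ _) (g m _ _) => a b c; ring.
Qed.

End KoszulFormula.

Section LiftedConnection.
Context {R : realType} {G : topologicalGroupCarrierType} {E : normedModType R}.
Context (A : atlas G E).
Hypotheses (fE : finite_dim E) (hA : manifold A).
Hypothesis hmul : smooth_map (product_atlas A A) A setT (fun xy => (xy.1 * xy.2)%g).
Local Notation TA := (tangent_atlas A).
Local Notation left_inv := (left_invariant (A := A) *%g).
Context (g : forms A) (hg : left_invariant_metric *%g g).
Context (c w : fields A -> fields (tangent_atlas A)).
Hypotheses (hc : forall X, vector_field X -> complete_lift X (c X))
  (hw : forall X, vector_field X -> vertical_lift X (w X)).
Context (gt : forms TA) (hgt : riemannian gt).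
Hypothesis gt_lift : forall X Y, left_inv X -> left_inv Y ->
  forall y, carrier TA y ->
  [/\ gt y (c X y) (c Y y) = g y.1 (X y.1) (Y y.1),
      gt y (w X y) (w Y y) = g y.1 (X y.1) (Y y.1) &
      gt y (c X y) (w Y y) = 0].
Context (D : fields TA -> fields TA -> fields TA) (hD : levi_civita gt D).
Implicit Types (X Y Z T : fields A) (y : bundle A).

Local Notation ip X Y := (g 1%g (X 1%g) (Y 1%g)).

Lemma inner_constant X Y m : left_inv X -> left_inv Y -> g m (X m) (Y m) = ip X Y.
Proof.
move=> lX lY; have [_ inv] := hg.
have C x : carrier A x by rewrite (manifold_cover hA).
have := inv m 1%g (X 1%g) (Y 1%g) (C _) (C _) (lX.1.1 _) (lY.1.1 _).
by rewrite !(left_inv_map hA) // mulg1.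
Qed.

Lemma inner_sym X Y : left_inv X -> left_inv Y -> ip X Y = ip Y X.
Proof. by move=> lX lY; apply: (riemannian_sym hg.1); [exact: lX.1.1|exact: lY.1.1]. Qed.

Lemma inner_lincombl (a : R) X Y Z : left_inv X -> left_inv Y -> left_inv Z ->
  ip (a *: X + Y) Z = a * ip X Z + ip Y Z.
Proof.
move=> lX lY lZ.
exact: (riemannian_linear hg.1 a (lX.1.1 _) (lY.1.1 _) (lZ.1.1 _)).
Qed.

Lemma gt_complete X Y y i : left_inv X -> left_inv Y -> @dom _ _ _ TA i y ->
  gt y (c X y) (c Y y) = ip X Y.
Proof.
move=> lX lY iy; have [-> _ _] := gt_lift lX lY (ex_intro2 _ _ i I iy).
exact: inner_constant.
Qed.

Lemma gt_vertical X Y y i : left_inv X -> left_inv Y -> @dom _ _ _ TA i y ->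
  gt y (w X y) (w Y y) = ip X Y.
Proof.
move=> lX lY iy; have [_ -> _] := gt_lift lX lY (ex_intro2 _ _ i I iy).
exact: inner_constant.
Qed.

Lemma gt_mixed X Y y i : left_inv X -> left_inv Y -> @dom _ _ _ TA i y ->
  gt y (c X y) (w Y y) = 0.
Proof. by move=> lX lY iy; have [] := gt_lift lX lY (ex_intro2 _ _ i I iy). Qed.

Let vc X : left_inv X -> vector_field (A := TA) (c X).
Proof. by move=> lX; apply: (field_complete hc); exact: lX.1. Qed.

Let vw X : left_inv X -> vector_field (A := TA) (w X).
Proof. by move=> lX; apply: (field_vertical hw); exact: lX.1. Qed.

Lemma gt_mixed_sym X Y y i : left_inv X -> left_inv Y -> @dom _ _ _ TA i y ->
  gt y (w X y) (c Y y) = 0.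
Proof.
move=> lX lY iy; rewrite (riemannian_sym hgt); first exact: gt_mixed iy.
  exact: (vw lX).1.
exact: (vc lY).1.
Qed.

(* Both lifts at once, so that one Koszul formula covers the eight cases. *)
Let liftb (b : bool) X := if b then c X else w X.

Let lift_field b X : left_inv X -> vector_field (A := TA) (liftb b X).
Proof. by case: b; [exact: vc|exact: vw]. Qed.

Let lift_const b b' X Y : left_inv X -> left_inv Y ->
  constant_product gt (liftb b X) (liftb b' Y).
Proof.
move=> lX lY; case: b; case: b'.
- by exists (ip X Y) => i y iy; exact: gt_complete iy.
- by exists 0 => i y iy; exact: gt_mixed iy.
- by exists 0 => i y iy; exact: gt_mixed_sym iy.
- by exists (ip X Y) => i y iy; exact: gt_vertical iy.
Qed.

Lemma open_tangent_chart (i : idx TA) : open (chart_image i).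
Proof.
have -> : chart_image i = [set r : E * E | chart_image (A := A) i r.1].
  apply/seteqP; split=> [r [y [iy _] <-]|[p q] /= /(in_tangent_chart hA q)].
    by exists y.1.
  by move=> [y [iy <- <-]]; exists y.
rewrite openE => -[p q] Cp.
exact: (near_fst q (near_open (open_chart_image hA i) Cp)).
Qed.

Lemma lift_koszul b1 b2 b3 X Y Z y : left_inv X -> left_inv Y -> left_inv Z ->
  2 * gt y (D (liftb b1 X) (liftb b2 Y) y) (liftb b3 Z y)
  = gt y (bracket (liftb b1 X) (liftb b2 Y) y) (liftb b3 Z y)
    - gt y (bracket (liftb b2 Y) (liftb b3 Z) y) (liftb b1 X y)
    + gt y (bracket (liftb b3 Z) (liftb b1 X) y) (liftb b2 Y y).
Proof.
move=> lX lY lZ; apply: (koszul_constant hgt hD open_tangent_chart).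
- exact: injective_tangent.
- exact: lift_field.
- exact: lift_field.
- exact: lift_field.
- exact: lift_const.
- exact: lift_const.
- exact: lift_const.
Qed.

(** The difference S - T is itself a sum of two lifts at each point, hence
    orthogonal to itself. *)
Lemma lift_product_eq (S T : fields TA) :
  vector_field (A := TA) S -> vector_field (A := TA) T ->
  (forall Z b y i, left_inv Z -> @dom _ _ _ TA i y ->
     gt y (S y) (liftb b Z y) = gt y (T y) (liftb b Z y)) -> S = T.
Proof.
move=> vS vT H; apply/funext => y.
have tS := vS.1 y; have tT := vT.1 y.
have [[i iy]|ny] := pselect (exists i, @dom _ _ _ TA i y); last first.
  apply/funext => i.
  have niy : ~ @dom _ _ _ TA i y by move=> iy; apply: ny; exists i.
  by rewrite tS.1 // tT.1.
have td : tangent (A := TA) y (- 1 *: T y + S y).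
  exact: (tangent_bundle_lincomb fE hA (- 1) tT tS).
have dE : - 1 *: T y + S y = S y - T y by rewrite scaleN1r addrC.
have LF X : left_inv X -> vector_field X by case.
have span := left_inv_exists fE hA hmul.
have [X [Y [lX lY XY]]] := lift_span fE hA hc hw LF span iy td.
have zero b Z : left_inv Z -> gt y (S y - T y) (liftb b Z y) = 0.
  move=> lZ; rewrite (form_sub hgt tS tT ((lift_field b lZ).1 y)).
  by rewrite (H Z b y i lZ iy) subrr.
rewrite dE in td XY.
have dd : gt y (S y - T y) (S y - T y) = 0.
  rewrite -[c X y]scale1r in XY.
  apply: (eq_trans (f_equal (fun t => gt y t (S y - T y)) XY)).
  rewrite (riemannian_linear hgt 1 ((vc lX).1 y) ((vw lY).1 y) td).
  rewrite (riemannian_sym hgt ((vc lX).1 y) td) (riemannian_sym hgt ((vw lY).1 y) td).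
  by rewrite (zero true) // (zero false) // mulr0 addr0.
apply/eqP; rewrite -subr_eq0; apply/negPn/negP => d0.
by have := riemannian_pos hgt td d0; rewrite dd ltxx.
Qed.

(** In each of the next four lemmas the products of the connection with one of
    the two kinds of lifts vanish, so that it is again a lift. The three brackets
    of the Koszul formula contribute exactly when their product is with a lift of
    the same kind. *)
Lemma connection_complete_complete X Y T : left_inv X -> left_inv Y -> left_inv T ->
  (forall Z, left_inv Z ->
    2 * ip T Z = ip (bracket X Y) Z - ip (bracket Y Z) X + ip (bracket Z X) Y) ->
  D (c X) (c Y) = c T.
Proof.
move=> lX lY lT H; apply: lift_product_eq.
- exact: (connection_field hD (vc lX) (vc lY)).
- exact: vc.
have n2 : (2 : R) != 0 by rewrite pnatr_eq0.
move=> Z b y i lZ iy; apply: (mulfI n2).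
have lXY := left_inv_bracket fE hA hmul lX lY.
have lYZ := left_inv_bracket fE hA hmul lY lZ.
have lZX := left_inv_bracket fE hA hmul lZ lX.
have := @lift_koszul true true b X Y Z y lX lY lZ; rewrite /= => ->.
have [vX vY vZ] : [/\ vector_field X, vector_field Y & vector_field Z].
  by split; [case: lX|case: lY|case: lZ].
case: b; rewrite /=.
  rewrite !(bracket_complete_complete fE hA hc) //.
  by rewrite !(gt_complete _ _ iy) // H.
rewrite (bracket_complete_complete fE hA hc) // (bracket_complete_vertical fE hA hc hw) //.
rewrite (bracket_vertical_complete fE hA hc hw) //.
by rewrite !(gt_mixed _ _ iy) // !(gt_mixed_sym _ _ iy) // subrr addr0 mulr0.
Qed.

Lemma connection_complete_vertical X Y T : left_inv X -> left_inv Y -> left_inv T ->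
  (forall Z, left_inv Z -> 2 * ip T Z = ip (bracket X Y) Z + ip (bracket Z X) Y) ->
  D (c X) (w Y) = w T.
Proof.
move=> lX lY lT H; apply: lift_product_eq.
- exact: (connection_field hD (vc lX) (vw lY)).
- exact: vw.
have n2 : (2 : R) != 0 by rewrite pnatr_eq0.
move=> Z b y i lZ iy; apply: (mulfI n2).
have lXY := left_inv_bracket fE hA hmul lX lY.
have lYZ := left_inv_bracket fE hA hmul lY lZ.
have lZX := left_inv_bracket fE hA hmul lZ lX.
have := @lift_koszul true false b X Y Z y lX lY lZ; rewrite /= => ->.
have [vX vY vZ] : [/\ vector_field X, vector_field Y & vector_field Z].
  by split; [case: lX|case: lY|case: lZ].
rewrite (bracket_complete_vertical fE hA hc hw) //.
case: b; rewrite /=.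
  rewrite (bracket_complete_complete fE hA hc) // (bracket_vertical_complete fE hA hc hw) //.
  by rewrite !(gt_mixed _ _ iy) // !(gt_mixed_sym _ _ iy) // subrr addr0 mulr0.
rewrite (bracket_vertical_vertical hA hw) // (bracket_vertical_complete fE hA hc hw) //.
rewrite (form0 hgt ((vc lX).1 y)) !(gt_vertical _ _ iy) // H //.
by rewrite subr0.
Qed.

Lemma connection_vertical_complete X Y T : left_inv X -> left_inv Y -> left_inv T ->
  (forall Z, left_inv Z -> 2 * ip T Z = ip (bracket X Y) Z - ip (bracket Y Z) X) ->
  D (w X) (c Y) = w T.
Proof.
move=> lX lY lT H; apply: lift_product_eq.
- exact: (connection_field hD (vw lX) (vc lY)).
- exact: vw.
have n2 : (2 : R) != 0 by rewrite pnatr_eq0.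
move=> Z b y i lZ iy; apply: (mulfI n2).
have lXY := left_inv_bracket fE hA hmul lX lY.
have lYZ := left_inv_bracket fE hA hmul lY lZ.
have lZX := left_inv_bracket fE hA hmul lZ lX.
have := @lift_koszul false true b X Y Z y lX lY lZ; rewrite /= => ->.
have [vX vY vZ] : [/\ vector_field X, vector_field Y & vector_field Z].
  by split; [case: lX|case: lY|case: lZ].
rewrite (bracket_vertical_complete fE hA hc hw) //.
case: b; rewrite /=.
  rewrite (bracket_complete_complete fE hA hc) // (bracket_complete_vertical fE hA hc hw) //.
  by rewrite !(gt_mixed _ _ iy) // !(gt_mixed_sym _ _ iy) // subrr addr0 mulr0.
rewrite (bracket_vertical_vertical hA hw) // (bracket_complete_vertical fE hA hc hw) //.
rewrite (form0 hgt ((vc lY).1 y)) !(gt_vertical _ _ iy) // H //.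
by rewrite addr0.
Qed.

Lemma connection_vertical_vertical X Y T : left_inv X -> left_inv Y -> left_inv T ->
  (forall Z, left_inv Z -> 2 * ip T Z = - ip (bracket Y Z) X + ip (bracket Z X) Y) ->
  D (w X) (w Y) = c T.
Proof.
move=> lX lY lT H; apply: lift_product_eq.
- exact: (connection_field hD (vw lX) (vw lY)).
- exact: vc.
have n2 : (2 : R) != 0 by rewrite pnatr_eq0.
move=> Z b y i lZ iy; apply: (mulfI n2).
have lXY := left_inv_bracket fE hA hmul lX lY.
have lYZ := left_inv_bracket fE hA hmul lY lZ.
have lZX := left_inv_bracket fE hA hmul lZ lX.
have := @lift_koszul false false b X Y Z y lX lY lZ; rewrite /= => ->.
have [vX vY vZ] : [/\ vector_field X, vector_field Y & vector_field Z].
  by split; [case: lX|case: lY|case: lZ].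
rewrite (bracket_vertical_vertical hA hw) //.
case: b; rewrite /=.
  rewrite (bracket_complete_vertical fE hA hc hw) // (bracket_vertical_complete fE hA hc hw) //.
  by rewrite (form0 hgt ((vc lZ).1 y)) !(gt_complete _ _ iy) // !(gt_vertical _ _ iy) // H // sub0r.
rewrite !(bracket_vertical_vertical hA hw) //.
rewrite (form0 hgt ((vw lZ).1 y)) (form0 hgt ((vw lX).1 y)) (form0 hgt ((vw lY).1 y)).
by rewrite (gt_mixed _ _ iy) // subrr addr0 mulr0.
Qed.

End LiftedConnection.

(** * Lie algebras with a two-dimensional derived algebra *)

Section Plane.
Context {R : realType} {G : topologicalGroupCarrierType} {E : normedModType R}.
Context (A : atlas G E).
Hypotheses (fE : finite_dim E) (hA : manifold A).
Hypothesis hmul : smooth_map (product_atlas A A) A setT (fun xy => (xy.1 * xy.2)%g).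
Local Notation left_inv := (left_invariant (A := A) *%g).
Context (g : forms A) (hg : left_invariant_metric *%g g).
Implicit Types (X Y Z T u v p q : fields A).
Local Notation ip X Y := (g 1%g (X 1%g) (Y 1%g)).

Local Notation derived := (derived_algebra (A := A) *%g).

Lemma derived_ind (K : fields A -> Prop) : K 0 ->
  (forall (s : R) X Y Z, left_inv X -> left_inv Y -> K Z -> K (s *: bracket X Y + Z)) ->
  forall Z, derived Z -> K Z.
Proof.
move=> K0 KS Z [n [s [X [Y [lX lY ->]]]]].
elim: n s X Y lX lY => [|n IH] s X Y lX lY; first by rewrite big_ord0.
by rewrite big_ord_recl; apply: KS => //; exact: IH.
Qed.

Definition linear_on (K : fields A -> R) : Prop := forall (s : R) X Y,
  left_inv X -> left_inv Y -> K (s *: X + Y) = s * K X + K Y.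

Lemma linear_on_ipr T : left_inv T -> linear_on (fun Z => ip T Z).
Proof.
move=> lT s X Y lX lY; have lXY := left_inv_lincomb fE hA hmul s lX lY.
by rewrite !(inner_sym hg lT) // inner_lincombl.
Qed.

Lemma linear_on_br X Y : left_inv X -> left_inv Y -> linear_on (fun Z => ip (bracket X Z) Y).
Proof.
move=> lX lY s Z T lZ lT; rewrite (bracket_lincombr hA); first last.
- by case: lX.
- by case: lT.
- by case: lZ.
by rewrite (inner_lincombl hg) //; exact: left_inv_bracket.
Qed.

Lemma linear_on_bl X Y : left_inv X -> left_inv Y -> linear_on (fun Z => ip (bracket Z X) Y).
Proof.
move=> lX lY s Z T lZ lT; rewrite (bracket_lincombl hA); first last.
- by case: lX.
- by case: lT.
- by case: lZ.
by rewrite (inner_lincombl hg) //; exact: left_inv_bracket.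
Qed.

Lemma linear_onD K L : linear_on K -> linear_on L -> linear_on (fun Z => K Z + L Z).
Proof. by move=> hK hL s X Y lX lY; rewrite hK // hL //; ring. Qed.

Lemma linear_onN K : linear_on K -> linear_on (fun Z => - K Z).
Proof. by move=> hK s X Y lX lY; rewrite hK //; ring. Qed.

Lemma linear_on0 K : linear_on K -> K 0 = 0.
Proof.
move=> hK; have := hK 1 0 0 (left_inv0 fE hA hmul) (left_inv0 fE hA hmul).
rewrite scale1r add0r; lra.
Qed.

(** The vectors e_1 and e_2 are indexed by the booleans true and false, so that
    the formulas for e_1 and for e_2 are instances of the same statement. *)
Context (e : bool -> fields A).
Hypotheses (le : forall i, left_inv (e i))
  (ee : forall i j, ip (e i) (e j) = (i == j)%:R).

Definition orth u : Prop := left_inv u /\ forall i, ip u (e i) = 0.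

Lemma orth0 : orth 0.
Proof.
split=> [|i]; first exact: left_inv0.
rewrite (inner_sym hg) //; last exact: left_inv0.
exact: (linear_on0 (linear_on_ipr (le i))).
Qed.

Lemma orth_lincomb (s : R) u v : orth u -> orth v -> orth (s *: u + v).
Proof.
move=> [lu u0] [lv v0]; split=> [|i]; first exact: left_inv_lincomb.
by rewrite inner_lincombl // u0 v0 mulr0 addr0.
Qed.

(** A general element of the Lie algebra, when q is orthogonal to the derived
    algebra: x are its coordinates along e. *)
Definition comb (x : bool -> R) q : fields A :=
  x true *: e true + (x false *: e false + q).

Lemma left_inv_comb x q : left_inv q -> left_inv (comb x q).
Proof. by move=> lq; do 2 apply: left_inv_lincomb => //. Qed.

Lemma linear_on_comb K x q : linear_on K -> left_inv q ->
  K (comb x q) = x true * K (e true) + x false * K (e false) + K q.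
Proof.
by move=> hK lq; rewrite /comb !hK // ?addrA //; exact: left_inv_lincomb.
Qed.

Lemma inner_comb_e x q k : orth q -> ip (comb x q) (e k) = x k.
Proof.
move=> [lq q0]; rewrite (inner_sym hg (left_inv_comb x lq) (le k)).
rewrite (linear_on_comb x (linear_on_ipr (le k)) lq) !ee.
by rewrite (inner_sym hg (le k) lq) q0; case: k; rewrite /=; lra.
Qed.

Lemma inner_comb_orth x q p : orth q -> orth p -> ip (comb x q) p = ip q p.
Proof.
move=> [lq q0] [lp p0]; rewrite (inner_sym hg (left_inv_comb x lq) lp).
rewrite (linear_on_comb x (linear_on_ipr lp) lq) !p0 (inner_sym hg lp lq); lra.
Qed.

Lemma comb_exists Z : left_inv Z -> exists2 p, orth p & Z = comb (fun i => ip Z (e i)) p.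
Proof.
move=> lZ; pose p := comb (fun i => - ip Z (e i)) Z.
have lp : left_inv p by exact: left_inv_comb.
exists p.
  split=> // k; rewrite (inner_sym hg lp (le k)).
  rewrite (linear_on_comb _ (linear_on_ipr (le k)) lZ) !ee (inner_sym hg (le k) lZ).
  by case: k; rewrite /=; lra.
rewrite /p /comb !scaleNr (addrCA (_ *: e false)) (addrA (_ *: e false) (- _)).
by rewrite subrr add0r addrA subrr add0r.
Qed.

Lemma linear_on_eq K L : linear_on K -> linear_on L ->
  (forall i, K (e i) = L (e i)) -> (forall p, orth p -> K p = L p) ->
  forall Z, left_inv Z -> K Z = L Z.
Proof.
move=> hK hL He Hp Z lZ; have [p op ->] := comb_exists lZ.
have [lp _] := op.
by rewrite (linear_on_comb _ hK lp) (linear_on_comb _ hL lp) !He Hp.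
Qed.

Hypotheses (e_derived : forall i, derived (e i))
  (derived_comb : forall Z, derived Z -> exists x, Z = comb x 0).

Lemma derived_bracket X Y : left_inv X -> left_inv Y -> derived (bracket X Y).
Proof.
move=> lX lY; exists 1%N, (fun=> 1), (fun=> X), (fun=> Y).
by split => //; rewrite big_ord1 scale1r.
Qed.

Lemma derived_span X Y : left_inv X -> left_inv Y -> exists x, bracket X Y = comb x 0.
Proof. by move=> lX lY; apply/derived_comb/derived_bracket. Qed.

Lemma left_inv_derived Z : derived Z -> left_inv Z.
Proof.
elim/derived_ind => [|s X Y T lX lY lT]; first exact: left_inv0.
by apply: left_inv_lincomb => //; exact: left_inv_bracket.
Qed.

Lemma orthP u : orth u <-> left_inv u /\ forall Z, derived Z -> ip u Z = 0.
Proof.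
split=> [ou|[lu u0]]; last by split=> // i; exact: u0.
have [lu _] := ou; split=> // Z /derived_comb[x ->].
have l0 := left_inv0 fE hA hmul.
rewrite (inner_sym hg lu (left_inv_comb x l0)) (inner_comb_orth x orth0 ou).
by rewrite (inner_sym hg l0 lu); exact: (linear_on0 (linear_on_ipr lu)).
Qed.

Lemma bracket_orth X Y p : left_inv X -> left_inv Y -> orth p ->
  ip (bracket X Y) p = 0.
Proof.
move=> lX lY /orthP[lp p0].
rewrite (inner_sym hg (left_inv_bracket fE hA hmul lX lY) lp).
exact: (p0 _ (derived_bracket lX lY)).
Qed.

Let ad X i j := ip (bracket X (e i)) (e j).

Lemma bracket_coord X i : left_inv X -> bracket X (e i) = comb (ad X i) 0.
Proof.
move=> lX; have [x xE] := derived_span lX (le i); rewrite xE; congr comb.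
by apply/funext => j; rewrite /ad xE (inner_comb_e _ _ orth0).
Qed.

Lemma ad_bracket X Y i k : left_inv X -> left_inv Y ->
  ip (bracket X (bracket Y (e i))) (e k)
  = ad Y i true * ad X true k + ad Y i false * ad X false k.
Proof.
move=> lX lY; rewrite (bracket_coord i lY).
have K := linear_on_br lX (le k).
by rewrite (linear_on_comb _ K (left_inv0 fE hA hmul)) (linear_on0 K) addr0.
Qed.

Let trace X := ad X true true + ad X false false.

(** By the Jacobi identity [ad [X, Y]] is the commutator of [ad X] and [ad Y] on
    the derived algebra, and commutators have trace zero. *)
Lemma trace_bracket X Y : left_inv X -> left_inv Y -> trace (bracket X Y) = 0.
Proof.
move=> lX lY.
have jac i k : ad (bracket X Y) i k
    = (ad Y i true * ad X true k + ad Y i false * ad X false k)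
      - (ad X i true * ad Y true k + ad X i false * ad Y false k).
  have lYe := left_inv_bracket fE hA hmul lY (le i).
  have lXe := left_inv_bracket fE hA hmul lX (le i).
  rewrite /ad (bracket_jacobi fE hA); [|by case: lX|by case: lY|by case: (le i)].
  apply: (eq_trans (form_sub hg.1 ((left_inv_bracket fE hA hmul lX lYe).1.1 _)
    ((left_inv_bracket fE hA hmul lY lXe).1.1 _) ((le k).1.1 _))).
  exact: (f_equal2 (fun s t => s - t) (ad_bracket i k lX lY) (ad_bracket i k lY lX)).
rewrite /trace (jac true true) (jac false false).
move: (ad X) (ad Y) => x y; ring.
Qed.

Lemma trace_derived Z : derived Z -> trace Z = 0.
Proof.
move=> dZ; have lin : linear_on trace by apply: linear_onD; exact: linear_on_bl.
suff [] : left_inv Z /\ trace Z = 0 by [].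
elim/derived_ind: dZ => [|s X Y T lX lY [lT tT]].
  by split; [exact: left_inv0|exact: linear_on0].
have lB := left_inv_bracket fE hA hmul lX lY.
split; first exact: left_inv_lincomb.
by rewrite lin // tT trace_bracket // mulr0 addr0.
Qed.

(** The trace of [ad e_1] is the second coordinate of [[e_1, e_2]], and that of
    [ad e_2] is minus the first one. *)
Lemma derived_abelian i j : bracket (e i) (e j) = 0.
Proof.
have B Z : bracket Z Z = 0.
  by apply/funext => m; apply/funext => k; rewrite /bracket subrr.
suff T : bracket (e true) (e false) = 0.
  case: i; case: j; rewrite ?B //.
  by rewrite bracket_anti T oppr0.
have lS := left_inv_bracket fE hA hmul (le true) (le false).
have zero k : ip (0 : fields A) (e k) = 0.
  rewrite (inner_sym hg (left_inv0 fE hA hmul) (le k)).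
  exact: (linear_on0 (linear_on_ipr (le k))).
have t1 := trace_derived (e_derived true).
have t2 := trace_derived (e_derived false).
rewrite /trace /ad B zero add0r in t1.
rewrite /trace /ad B zero addr0 in t2.
rewrite (bracket_coord false (le true)) /comb /ad t1.
suff -> : ip (bracket (e true) (e false)) (e true) = 0.
  by rewrite !scale0r !addr0.
have anti : - 1 *: bracket (e true) (e false) + 0 = bracket (e false) (e true).
  by rewrite addr0 scaleN1r (bracket_anti (e true) (e false)).
have l0 := left_inv0 fE hA hmul.
have := inner_lincombl hg (- 1) lS l0 (le true).
rewrite anti t2 zero; lra.
Qed.

(** [a i j] represents the linear form giving the coordinate along [e j] of the
    bracket with [e i], so that a_1, a_2, b_1, b_2 are the four vectors [a i j]
    in lexicographic order. *)
Context (a : bool -> bool -> fields A) (f : bool -> fields A -> fields A).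
Hypotheses (oa : forall i j, orth (a i j)) (orth_f : forall i u, orth u -> orth (f i u))
  (f_skew : forall i u v, orth u -> orth v -> ip (f i u) v = - ip u (f i v)).
Hypotheses
  (bracket_ue : forall u i, orth u ->
     bracket u (e i) = comb (fun j => ip (a i j) u) 0)
  (bracket_uv : forall u v, orth u -> orth v ->
     bracket u v = comb (fun j => ip (f j u) v) 0).

Lemma inner_zero Z : left_inv Z -> ip (0 : fields A) Z = 0.
Proof.
move=> lZ; rewrite (inner_sym hg (left_inv0 fE hA hmul) lZ).
exact: (linear_on0 (linear_on_ipr lZ)).
Qed.

Lemma inner_ee i j Z : left_inv Z -> ip (bracket (e i) (e j)) Z = 0.
Proof. by move=> lZ; rewrite derived_abelian inner_zero. Qed.

Lemma inner_ue u i k : orth u -> ip (bracket u (e i)) (e k) = ip (a i k) u.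
Proof. by move=> ou; rewrite bracket_ue // (inner_comb_e _ _ orth0). Qed.

Lemma inner_eu u i k : orth u -> ip (bracket (e i) u) (e k) = - ip (a i k) u.
Proof.
move=> ou; rewrite -inner_ue // bracket_anti.
have [lu _] := ou; have lb := left_inv_bracket fE hA hmul lu (le i).
have lbN : left_inv (- bracket u (e i)).
  rewrite -scaleN1r -[X in left_inv X]addr0; apply: left_inv_lincomb => //.
  exact: left_inv0.
have := linear_on_ipr (le k) (-1) lb (left_inv0 fE hA hmul).
rewrite scaleN1r addr0 (linear_on0 (linear_on_ipr (le k))) => E1.
by rewrite (inner_sym hg lbN (le k)) E1 (inner_sym hg (le k) lb) mulN1r addr0.
Qed.

Lemma inner_uv u v k : orth u -> orth v -> ip (bracket u v) (e k) = ip (f k u) v.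
Proof. by move=> ou ov; rewrite bracket_uv // (inner_comb_e _ _ orth0). Qed.

Lemma inner_skew i u v : orth u -> orth v -> ip (f i u) v = - ip (f i v) u.
Proof.
move=> ou ov; rewrite f_skew //; have [lu _] := ou; have [lf _] := orth_f i ov.
by rewrite (inner_sym hg lu lf).
Qed.

Lemma inner_oe p k : orth p -> ip p (e k) = 0.
Proof. by case. Qed.

Lemma inner_lin2 (r s : R) u v p : orth u -> orth v -> orth p ->
  ip (r *: u + s *: v) p = r * ip u p + s * ip v p.
Proof.
move=> [lu _] [lv _] [lp _].
have E' : s *: v = s *: v + 0 by rewrite addr0.
have l0 := left_inv0 fE hA hmul.
rewrite {1}E' !inner_lincombl //; last exact: left_inv_lincomb.
by rewrite (inner_zero lp) addr0.
Qed.

Lemma orth_scale (r : R) u : orth u -> orth (r *: u).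
Proof. by move=> ou; rewrite -[_ *: u]addr0; apply: orth_lincomb => //; exact: orth0. Qed.

Lemma orth_lin2 (r s : R) u v : orth u -> orth v -> orth (r *: u + s *: v).
Proof. by move=> ou ov; apply: orth_lincomb => //; exact: orth_scale. Qed.

Lemma inner_scale (r : R) u p : orth u -> orth p -> ip (r *: u) p = r * ip u p.
Proof.
move=> ou op; have := inner_lin2 r 0 ou orth0 op.
by rewrite scaler0 addr0 mul0r addr0.
Qed.

(** Both lifts are linear, and are expanded by the same rules. *)
Section LinearLift.
Context (V : lmodType R) (L : fields A -> V).
Hypothesis L_lin : forall (s : R) X Y, left_inv X -> left_inv Y ->
  L (s *: X + Y) = s *: L X + L Y.

Lemma lift_zero : L 0 = 0.
Proof.
have l0 := left_inv0 fE hA hmul; have := L_lin 1 l0 l0.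
rewrite !scale1r add0r => E'; apply: (@addrI _ (L 0)).
by rewrite addr0; exact: esym E'.
Qed.

Lemma lift_scale (r : R) q : left_inv q -> L (r *: q) = r *: L q.
Proof.
move=> lq; rewrite -[r *: q]addr0 L_lin ?lift_zero ?addr0 //; exact: left_inv0.
Qed.

Lemma lift_comb x q : left_inv q ->
  L (comb x q) = x true *: L (e true) + (x false *: L (e false) + L q).
Proof. by move=> lq; rewrite /comb !L_lin //; exact: left_inv_lincomb. Qed.

Lemma lift_comb_scale x (r : R) q : left_inv q ->
  L (comb x (r *: q)) = x true *: L (e true) + (x false *: L (e false) + r *: L q).
Proof.
move=> lq; rewrite lift_comb ?lift_scale // -[_ *: q]addr0.
by apply: left_inv_lincomb => //; exact: left_inv0.
Qed.

Lemma lift_comb0 x : L (comb x 0) = x true *: L (e true) + x false *: L (e false).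
Proof. by rewrite lift_comb ?lift_zero ?addr0 //; exact: left_inv0. Qed.

Lemma lift_half q q' : left_inv q -> left_inv q' ->
  L (2^-1 *: q + 2^-1 *: q') = 2^-1 *: (L q + L q').
Proof.
move=> lq lq'; rewrite L_lin // ?lift_scale ?scalerDr //.
by rewrite -[_ *: q']addr0; apply: left_inv_lincomb => //; exact: left_inv0.
Qed.

End LinearLift.

Lemma comb0 q : comb (fun=> 0) q = q.
Proof. by rewrite /comb !scale0r !add0r. Qed.

Context (c w : fields A -> fields (tangent_atlas A)).
Hypotheses (hc : forall X, vector_field X -> complete_lift X (c X))
  (hw : forall X, vector_field X -> vertical_lift X (w X)).
Context (gt : forms (tangent_atlas A)) (hgt : riemannian gt).
Hypothesis gt_lift : forall X Y, left_inv X -> left_inv Y ->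
  forall y, carrier (tangent_atlas A) y ->
  [/\ gt y (c X y) (c Y y) = g y.1 (X y.1) (Y y.1),
      gt y (w X y) (w Y y) = g y.1 (X y.1) (Y y.1) &
      gt y (c X y) (w Y y) = 0].
Context (D : fields (tangent_atlas A) -> fields (tangent_atlas A) ->
  fields (tangent_atlas A)) (hD : levi_civita gt D).

Let left_orth u : orth u -> left_inv u. Proof. by case. Qed.

(** The four formulas for the connection, with the test fields restricted to
    [e k] and to the fields p orthogonal to the derived algebra. A bracket is in
    the derived algebra, which removes the term [<[X, Y], p>]. *)
Lemma criterion_cc X Y x q : left_inv X -> left_inv Y -> orth q ->
  (forall k, 2 * x k = ip (bracket X Y) (e k) - ip (bracket Y (e k)) X
     + ip (bracket (e k) X) Y) ->
  (forall p, orth p -> 2 * ip q p = - ip (bracket Y p) X + ip (bracket p X) Y) ->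
  D (c X) (c Y) = c (comb x q).
Proof.
move=> lX lY oq He Hp; have lT := left_inv_comb x (left_orth oq).
have lB := left_inv_bracket fE hA hmul lX lY.
apply: (connection_complete_complete fE hA hmul hg hc hw hgt gt_lift hD) => //.
apply: linear_on_eq.
- by move=> s Z Z' lZ lZ'; rewrite (linear_on_ipr lT) //; ring.
- apply: linear_onD; last exact: linear_on_bl.
  apply: linear_onD; first exact: linear_on_ipr.
  by apply: linear_onN; exact: linear_on_br.
- by move=> k; rewrite inner_comb_e.
- move=> p op; rewrite inner_comb_orth // Hp // (bracket_orth _ _ op) //.
  by rewrite sub0r.
Qed.

Lemma criterion_cw X Y x q : left_inv X -> left_inv Y -> orth q ->
  (forall k, 2 * x k = ip (bracket X Y) (e k) + ip (bracket (e k) X) Y) ->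
  (forall p, orth p -> 2 * ip q p = ip (bracket p X) Y) ->
  D (c X) (w Y) = w (comb x q).
Proof.
move=> lX lY oq He Hp; have lT := left_inv_comb x (left_orth oq).
have lB := left_inv_bracket fE hA hmul lX lY.
apply: (connection_complete_vertical fE hA hmul hg hc hw hgt gt_lift hD) => //.
apply: linear_on_eq.
- by move=> s Z Z' lZ lZ'; rewrite (linear_on_ipr lT) //; ring.
- by apply: linear_onD; [exact: linear_on_ipr|exact: linear_on_bl].
- by move=> k; rewrite inner_comb_e.
- move=> p op; rewrite inner_comb_orth // Hp // (bracket_orth _ _ op) //.
  by rewrite add0r.
Qed.

Lemma criterion_wc X Y x q : left_inv X -> left_inv Y -> orth q ->
  (forall k, 2 * x k = ip (bracket X Y) (e k) - ip (bracket Y (e k)) X) ->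
  (forall p, orth p -> 2 * ip q p = - ip (bracket Y p) X) ->
  D (w X) (c Y) = w (comb x q).
Proof.
move=> lX lY oq He Hp; have lT := left_inv_comb x (left_orth oq).
have lB := left_inv_bracket fE hA hmul lX lY.
apply: (connection_vertical_complete fE hA hmul hg hc hw hgt gt_lift hD) => //.
apply: linear_on_eq.
- by move=> s Z Z' lZ lZ'; rewrite (linear_on_ipr lT) //; ring.
- apply: linear_onD; first exact: linear_on_ipr.
  by apply: linear_onN; exact: linear_on_br.
- by move=> k; rewrite inner_comb_e.
- move=> p op; rewrite inner_comb_orth // Hp // (bracket_orth _ _ op) //.
  by rewrite add0r.
Qed.

Lemma criterion_ww X Y x q : left_inv X -> left_inv Y -> orth q ->
  (forall k, 2 * x k = - ip (bracket Y (e k)) X + ip (bracket (e k) X) Y) ->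
  (forall p, orth p -> 2 * ip q p = - ip (bracket Y p) X + ip (bracket p X) Y) ->
  D (w X) (w Y) = c (comb x q).
Proof.
move=> lX lY oq He Hp; have lT := left_inv_comb x (left_orth oq).
apply: (connection_vertical_vertical fE hA hmul hg hc hw hgt gt_lift hD) => //.
apply: linear_on_eq.
- by move=> s Z Z' lZ lZ'; rewrite (linear_on_ipr lT) //; ring.
- apply: linear_onD; last exact: linear_on_bl.
  by apply: linear_onN; exact: linear_on_br.
- by move=> k; rewrite inner_comb_e.
- by move=> p op; rewrite inner_comb_orth // Hp.
Qed.

Variables (u v : fields A) (ou : orth u) (ov : orth v).
#[local] Hint Resolve le ou ov oa orth_f orth0 orth_scale orth_lin2 left_orth : core.

(** The products of brackets with the basis fields, which decide each case of the
    criteria. *)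
Let inner_table := (inner_ee, inner_ue, inner_eu, inner_uv, bracket_orth, inner_oe,
  inner_lin2, inner_scale, inner_zero).
Ltac table := rewrite ?inner_table; auto; try lra.
Ltac by_table crit :=
  apply: crit; [by auto|by auto|by auto|by move=> k; table|move=> p op; table].

Lemma connection_plane i j :
  [/\ D (c (e i)) (c (e j)) = c (2^-1 *: a i j + 2^-1 *: a j i),
      D (c (e i)) (w (e j)) = w (2^-1 *: a i j),
      D (w (e i)) (c (e j)) = w (2^-1 *: a j i) &
      D (w (e i)) (w (e j)) = c (2^-1 *: a i j + 2^-1 *: a j i)].
Proof.
split; match goal with |- _ = _ ?T => rewrite -(comb0 T) end;
  [by_table criterion_cc|by_table criterion_cw
       |by_table criterion_wc|by_table criterion_ww].
Qed.

Lemma connection_plane_orth i :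
  [/\ D (c (e i)) (c u)
      = c (comb (fun j => - (2^-1 * (ip (a i j) u + ip (a j i) u))) (- 2^-1 *: f i u)),
      D (c (e i)) (w u) = w (comb (fun j => - (2^-1 * ip (a i j) u)) 0),
      D (w (e i)) (c u)
      = w (comb (fun j => - (2^-1 * (ip (a i j) u + ip (a j i) u))) (- 2^-1 *: f i u)) &
      D (w (e i)) (w u)
      = c (comb (fun j => - (2^-1 * ip (a j i) u)) (- 2^-1 *: f i u))].
Proof.
split; [by_table criterion_cc|by_table criterion_cw
       |by_table criterion_wc|by_table criterion_ww].
Qed.

Lemma connection_orth_plane i :
  [/\ D (c v) (c (e i))
      = c (comb (fun j => 2^-1 * (ip (a i j) v - ip (a j i) v)) (- 2^-1 *: f i v)),
      D (c v) (w (e i))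
      = w (comb (fun j => 2^-1 * (ip (a i j) v - ip (a j i) v)) (- 2^-1 *: f i v)),
      D (w v) (c (e i)) = w (comb (fun j => 2^-1 * ip (a i j) v) 0) &
      D (w v) (w (e i))
      = c (comb (fun j => - (2^-1 * ip (a j i) v)) (- 2^-1 *: f i v))].
Proof.
split; [by_table criterion_cc|by_table criterion_cw
       |by_table criterion_wc|by_table criterion_ww].
all: by rewrite (inner_skew _ op ov); lra.
Qed.

Lemma connection_orth :
  [/\ D (c v) (c u) = c (comb (fun j => 2^-1 * ip (f j v) u) 0),
      D (c v) (w u) = w (comb (fun j => 2^-1 * ip (f j v) u) 0),
      D (w v) (c u) = w (comb (fun j => 2^-1 * ip (f j v) u) 0) &
      D (w v) (w u) = c 0].
Proof.
split; [by_table criterion_cc|by_table criterion_cw|by_table criterion_wc|].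
have -> : 0 = comb (fun=> 0) 0 by rewrite comb0.
by_table criterion_ww.
Qed.

End Plane.

(** * The connection of the lifted metric *)

(** The shapes in which the formulas are stated, compared with their coordinates. *)
Section ScaledSums.
Context {R : realType} {V : lmodType R}.
Implicit Types (X Y Z : V) (h r s x y : R).

Lemma scaled_sum2 h r s x y X Y : x = h * r -> y = h * s ->
  x *: X + y *: Y = h *: (r *: X + s *: Y).
Proof. by move=> -> ->; rewrite scalerDr !scalerA. Qed.

Lemma scaled_sum2N h r s x y X Y : x = - (h * r) -> y = - (h * s) ->
  x *: X + y *: Y = - (h *: (r *: X + s *: Y)).
Proof. by move=> -> ->; rewrite !scaleNr -opprD scalerDr !scalerA. Qed.

Lemma scaled_sum3N h r s x y X Y Z : x = - r -> y = - s ->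
  x *: X + (y *: Y + - h *: Z) = - (r *: X + s *: Y + h *: Z).
Proof. by move=> -> ->; rewrite !scaleNr -!opprD addrA. Qed.

Lemma scaled_sum3hN h r s x y X Y Z : x = - (h * r) -> y = - (h * s) ->
  x *: X + (y *: Y + - h *: Z) = - (h *: (r *: X + s *: Y + Z)).
Proof. by move=> -> ->; rewrite !scaleNr -!opprD addrA !scalerDr !scalerA. Qed.

Lemma scaled_sum3_fst h s x y X Y Z : x = 0 -> y = h * s ->
  x *: X + (y *: Y + - h *: Z) = h *: (s *: Y - Z).
Proof. by move=> -> ->; rewrite scale0r add0r scaleNr scalerBr scalerA. Qed.

Lemma scaled_sum3_snd h r x y X Y Z : x = h * r -> y = 0 ->
  x *: X + (y *: Y + - h *: Z) = h *: (r *: X - Z).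
Proof. by move=> -> ->; rewrite scale0r add0r scaleNr scalerBr scalerA. Qed.

End ScaledSums.

Ltac scalars := solve [reflexivity|rewrite /inner;
  repeat match goal with x := _ |- _ => progress (unfold x) end; rewrite /=; lra].

Theorem lemma3p1 (R : realType) (n : nat) (G : topologicalGroupCarrierType)
  (A : atlas G 'rV[R]_n)
  (hG : lie_group A) (hGc : connected [set: G])
  (g : forms A) (hg : left_invariant_metric *%g g)
  (e1 e2 : fields A)
  (he : orthonormal_basis g (derived_algebra *%g) e1 e2)
  (P : set (fields A))
  (hP : P = orthogonal_complement g (derived_algebra *%g))
  (a1 a2 b1 b2 : fields A)
  (ha1 : P a1) (ha2 : P a2) (hb1 : P b1) (hb2 : P b2)
  (f1 f2 : fields A -> fields A)
  (hf1 : skew_symmetric_map g P f1) (hf2 : skew_symmetric_map g P f2)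
  (hue1 : forall u, P u -> bracket u e1 = inner g a1 u *: e1 + inner g a2 u *: e2)
  (hue2 : forall u, P u -> bracket u e2 = inner g b1 u *: e1 + inner g b2 u *: e2)
  (huv : forall u v, P u -> P v ->
    bracket u v = inner g (f1 u) v *: e1 + inner g (f2 u) v *: e2)
  (c w : fields A -> fields (tangent_atlas A))
  (hc : forall X, vector_field X -> complete_lift X (c X))
  (hw : forall X, vector_field X -> vertical_lift X (w X))
  (gt : forms (tangent_atlas A)) (hgt : lifted_metric g c w gt)
  (D : fields (tangent_atlas A) -> fields (tangent_atlas A) ->
       fields (tangent_atlas A))
  (hD : levi_civita gt D)
  (u v : fields A) (hu : P u) (hv : P v) :
  (D (c e1) (c e1) = c a1 /\
   D (c e1) (w e1) = 2^-1 *: w a1 /\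
   D (c e1) (c e2) = 2^-1 *: (c a2 + c b1) /\
   D (c e1) (w e2) = 2^-1 *: w a2 /\
   D (c e1) (c u) = - (inner g a1 u *: c e1
                       + (2^-1 * inner g (b1 + a2) u) *: c e2
                       + 2^-1 *: c (f1 u)) /\
   D (c e1) (w u) = - (2^-1 *: (inner g a1 u *: w e1 + inner g a2 u *: w e2)))
  /\
  (D (w e1) (c e1) = 2^-1 *: w a1 /\
   D (w e1) (w e1) = c a1 /\
   D (w e1) (c e2) = 2^-1 *: w b1 /\
   D (w e1) (w e2) = 2^-1 *: (c a2 + c b1) /\
   D (w e1) (c u) = - (inner g a1 u *: w e1
                       + (2^-1 * inner g (b1 + a2) u) *: w e2
                       + 2^-1 *: w (f1 u)) /\
   D (w e1) (w u) = - (2^-1 *: (inner g a1 u *: c e1 + inner g b1 u *: c e2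
                                + c (f1 u))))
  /\
  (D (c e2) (c e1) = 2^-1 *: (c a2 + c b1) /\
   D (c e2) (w e1) = 2^-1 *: w b1 /\
   D (c e2) (c e2) = c b2 /\
   D (c e2) (w e2) = 2^-1 *: w b2 /\
   D (c e2) (c u) = - ((2^-1 * inner g (b1 + a2) u) *: c e1
                       + inner g b2 u *: c e2
                       + 2^-1 *: c (f2 u)) /\
   D (c e2) (w u) = - (2^-1 *: (inner g b1 u *: w e1 + inner g b2 u *: w e2)))
  /\
  (D (w e2) (c e1) = 2^-1 *: w a2 /\
   D (w e2) (w e1) = 2^-1 *: (c a2 + c b1) /\
   D (w e2) (c e2) = 2^-1 *: w b2 /\
   D (w e2) (w e2) = c b2 /\
   D (w e2) (c u) = - ((2^-1 * inner g (b1 + a2) u) *: w e1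
                       + inner g b2 u *: w e2
                       + 2^-1 *: w (f2 u)) /\
   D (w e2) (w u) = - (2^-1 *: (inner g a2 u *: c e1 + inner g b2 u *: c e2
                                + c (f2 u))))
  /\
  (D (c v) (c e1) = 2^-1 *: (inner g (a2 - b1) v *: c e2 - c (f1 v)) /\
   D (c v) (w e1) = 2^-1 *: (inner g (a2 - b1) v *: w e2 - w (f1 v)) /\
   D (c v) (c e2) = 2^-1 *: (inner g (b1 - a2) v *: c e1 - c (f2 v)) /\
   D (c v) (w e2) = 2^-1 *: (inner g (b1 - a2) v *: w e1 - w (f2 v)) /\
   D (c v) (c u) = 2^-1 *: (inner g (f1 v) u *: c e1
                            + inner g (f2 v) u *: c e2) /\
   D (c v) (w u) = 2^-1 *: (inner g (f1 v) u *: w e1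
                            + inner g (f2 v) u *: w e2))
  /\
  (D (w v) (c e1) = 2^-1 *: (inner g a1 v *: w e1 + inner g a2 v *: w e2) /\
   D (w v) (w e1) = - (2^-1 *: (inner g a1 v *: c e1 + inner g b1 v *: c e2
                                + c (f1 v))) /\
   D (w v) (c e2) = 2^-1 *: (inner g b1 v *: w e1 + inner g b2 v *: w e2) /\
   D (w v) (w e2) = - (2^-1 *: (inner g a2 v *: c e1 + inner g b2 v *: c e2
                                + c (f2 v))) /\
   D (w v) (c u) = 2^-1 *: (inner g (f1 v) u *: w e1
                            + inner g (f2 v) u *: w e2) /\
   D (w v) (w u) = 0).
Proof.
have fE := @finite_dim_rV R n; have hA := lie_group_manifold hG.
have hmul := lie_group_mul hG.
have [hgt_inv gt_lift] := hgt; have [hgtr _] := hgt_inv.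
have [d1 d2 [n1 n2 n12] sp] := he.
pose e (b : bool) := if b then e1 else e2.
pose a (i j : bool) := if i then if j then a1 else a2 else if j then b1 else b2.
pose f (i : bool) := if i then f1 else f2.
have l1 := left_inv_derived fE hA hmul d1.
have l2 := left_inv_derived fE hA hmul d2.
have le i : left_invariant *%g (e i) by case: i.
have ee i j : inner g (e i) (e j) = (i == j)%:R.
  by case: i; case: j => //; rewrite /e /inner (inner_sym hg).
have ed i : derived_algebra *%g (e i) by case: i.
have dc Z : derived_algebra *%g Z -> exists x, Z = comb e x 0.
  move=> /sp[x1 [x2 ->]]; exists (fun b => if b then x1 else x2).
  by rewrite /comb addr0.
have oP x : P x <-> orth g e x.
  by rewrite hP; symmetry; exact: (orthP fE hA hmul hg le ed dc).
have oa i j : orth g e (a i j) by apply/oP; case: i; case: j.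
have orth_f i x : orth g e x -> orth g e (f i x).
  by move=> /oP Px; apply/oP; case: i; [case: hf1 => + _ _|case: hf2 => + _ _]; exact.
have fs i x y : orth g e x -> orth g e y -> inner g (f i x) y = - inner g x (f i y).
  by move=> /oP Px /oP Py; case: i; [case: hf1 => _ _|case: hf2 => _ _]; exact.
have bue x i : orth g e x -> bracket x (e i) = comb e (fun j => inner g (a i j) x) 0.
  by move=> /oP Px; rewrite /comb addr0; case: i; [exact: hue1|exact: hue2].
have buv x y : orth g e x -> orth g e y ->
    bracket x y = comb e (fun j => inner g (f j x) y) 0.
  by move=> /oP Px /oP Py; rewrite /comb addr0; exact: huv.
have ou := (oP u).1 hu; have ov := (oP v).1 hv.
have T1 := connection_plane fE hA hmul hg le ee ed dc oa bue hc hw hgtr gt_lift hD.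
have T2 := connection_plane_orth fE hA hmul hg le ee ed dc orth_f bue buv hc hw hgtr gt_lift hD ou.
have T3 := connection_orth_plane fE hA hmul hg le ee ed dc orth_f fs bue buv hc hw hgtr gt_lift hD ov.
have T4 := connection_orth fE hA hmul hg le ee ed dc buv hc hw hgtr gt_lift hD ou ov.
have LF X : left_invariant *%g X -> vector_field X by case.
have clin s X Y : left_invariant *%g X -> left_invariant *%g Y ->
    c (s *: X + Y) = s *: c X + c Y.
  by move=> /LF vX /LF vY; exact: (complete_lincomb fE hA hc).
have wlin s X Y : left_invariant *%g X -> left_invariant *%g Y ->
    w (s *: X + Y) = s *: w X + w Y.
  by move=> /LF vX /LF vY; exact: (vertical_lincomb hA hw).
have la i j : left_invariant *%g (a i j) by case: (oa i j).
have lf i x : orth g e x -> left_invariant *%g (f i x) by move=> /(orth_f i)[].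
have Cs := lift_comb_scale fE hA hmul le clin.
have Ws := lift_comb_scale fE hA hmul le wlin.
have C0 := lift_comb0 fE hA hmul le clin.
have W0 := lift_comb0 fE hA hmul le wlin.
have Ch i j k l := lift_half fE hA hmul clin (la i j) (la k l).
have Wz i j := lift_scale fE hA hmul wlin 2^-1 (la i j).
have half (x : fields (tangent_atlas A)) : 2^-1 *: (x + x) = x.
  by rewrite -mulr2n -[x *+ 2]scaler_nat scalerA mulVf ?pnatr_eq0 // scale1r.
have innerD x y z : P x -> P y -> P z -> inner g (x + y) z = inner g x z + inner g y z.
  move=> /oP[lx _] /oP[ly _] /oP[lz _].
  by have := inner_lincombl hg 1 lx ly lz; rewrite scale1r mul1r.
have innerB x y z : P x -> P y -> P z -> inner g (x - y) z = inner g x z - inner g y z.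
  move=> /oP[lx _] /oP[ly _] /oP[lz _].
  have := inner_lincombl hg (-1) ly lx lz; rewrite scaleN1r mulN1r.
  by rewrite addrC [RHS]addrC.
rewrite (innerD _ _ _ hb1 ha2 hu) (innerB _ _ _ ha2 hb1 hv) (innerB _ _ _ hb1 ha2 hv).
split; last split; last split; last split; last split.
- have [E1 E2 _ _] := T1 true true; have [E3 E4 _ _] := T1 true false.
  have [E5 E6 _ _] := T2 true; do ![split].
  + by rewrite E1 Ch half.
  + by rewrite E2 Wz.
  + by rewrite E3 Ch.
  + by rewrite E4 Wz.
  + by rewrite E5 Cs; [apply: scaled_sum3N; scalars|exact: lf].
  + by rewrite E6 W0; apply: scaled_sum2N; scalars.
- have [_ _ E1 E2] := T1 true true; have [_ _ E3 E4] := T1 true false.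
  have [_ _ E5 E6] := T2 true; do ![split].
  + by rewrite E1 Wz.
  + by rewrite E2 Ch half.
  + by rewrite E3 Wz.
  + by rewrite E4 Ch.
  + by rewrite E5 Ws; [apply: scaled_sum3N; scalars|exact: lf].
  + by rewrite E6 Cs; [apply: scaled_sum3hN; scalars|exact: lf].
- have [E1 E2 _ _] := T1 false true; have [E3 E4 _ _] := T1 false false.
  have [E5 E6 _ _] := T2 false; do ![split].
  + by rewrite E1 Ch addrC.
  + by rewrite E2 Wz.
  + by rewrite E3 Ch half.
  + by rewrite E4 Wz.
  + by rewrite E5 Cs; [apply: scaled_sum3N; scalars|exact: lf].
  + by rewrite E6 W0; apply: scaled_sum2N; scalars.
- have [_ _ E1 E2] := T1 false true; have [_ _ E3 E4] := T1 false false.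
  have [_ _ E5 E6] := T2 false; do ![split].
  + by rewrite E1 Wz.
  + by rewrite E2 Ch addrC.
  + by rewrite E3 Wz.
  + by rewrite E4 Ch half.
  + by rewrite E5 Ws; [apply: scaled_sum3N; scalars|exact: lf].
  + by rewrite E6 Cs; [apply: scaled_sum3hN; scalars|exact: lf].
- have [E1 E2 _ _] := T3 true; have [E3 E4 _ _] := T3 false.
  have [E5 E6 _ _] := T4; do ![split].
  + by rewrite E1 Cs; [apply: scaled_sum3_fst; scalars|exact: lf].
  + by rewrite E2 Ws; [apply: scaled_sum3_fst; scalars|exact: lf].
  + by rewrite E3 Cs; [apply: scaled_sum3_snd; scalars|exact: lf].
  + by rewrite E4 Ws; [apply: scaled_sum3_snd; scalars|exact: lf].
  + by rewrite E5 C0; apply: scaled_sum2; scalars.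
  + by rewrite E6 W0; apply: scaled_sum2; scalars.
- have [_ _ E1 E2] := T3 true; have [_ _ E3 E4] := T3 false.
  have [_ _ E5 E6] := T4; do ![split].
  + by rewrite E1 W0; apply: scaled_sum2; scalars.
  + by rewrite E2 Cs; [apply: scaled_sum3hN; scalars|exact: lf].
  + by rewrite E3 W0; apply: scaled_sum2; scalars.
  + by rewrite E4 Cs; [apply: scaled_sum3hN; scalars|exact: lf].
  + by rewrite E5 W0; apply: scaled_sum2; scalars.
  + by rewrite E6 (lift_zero fE hA hmul clin).
Qed.
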